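(* Let $d$ be even and, for an integer $L$, let ${\Gamma}=\{x\in\mathbb{Z}^d\mid 0\le x_\mu<L\}$ be the periodic lattice (lattice spacing $1$). Let the gauge group be $G=\mathrm{U}(1)$ and consider periodic admissible gauge fields on ${\Gamma}$ (as in the context), with a Ginsparg–Wilson Dirac operator $D$ on ${\Gamma}$ and its infinite-lattice counterpart $D^\infty$ satisfying the standing assumptions of the context, with localization range $\varrho$. Then there is a constant $n$ such that, whenever $L/\varrho\ge n$, for every such gauge field the axial anomaly on the finite lattice satisfies $$\mathcal{A}(x)=q(x)+\partial_\mu^*k_\mu(x)\qquad (x\in{\Gamma}),$$ where $k_\mu(x)$ is a gauge invariant periodic current on ${\Gamma}$, and moreover $$|k_\mu(x)-k_\mu^\infty(x)|\le \kappa_1L^{\nu_1}e^{-L/\varrho}$$ for some constants $\kappa_1,\nu_1$.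
   Context: Setting. $d$ is even; ${\Gamma}=\{x\in\mathbb{Z}^d: 0\le x_\mu<L\}$; $\hat\mu$ is the unit vector in direction $\mu$. The link variables $U(x,\mu)\in\mathrm{U}(1)$ are periodic, $U(x+L\hat\nu,\mu)=U(x,\mu)$; on the infinite lattice $\mathbb{Z}^d$ one always uses the periodic extension of such a configuration. $U(x,\mu,\nu)$ is the plaquette variable. Admissibility: $\|1-U(x,\mu,\nu)\|<\epsilon$ for all $x,\mu,\nu$, with a fixed $\epsilon<\min\{1,(2-\sqrt2)/(d(d-1))\}$, and in addition $|F_{\mu\nu}(x)/i|<\pi/3$, where $F_{\mu\nu}(x)=\ln U(x,\mu,\nu)$ with $-\pi<F_{\mu\nu}(x)/i\le\pi$. Difference operators: $\partial_\mu f(x)=f(x+\hat\mu)-f(x)$, $\partial^*_\mu f(x)=f(x)-f(x-\hat\mu)$; repeated indices are summed. Dirac operators. $D(x,y)$ is a gauge covariant Dirac operator on ${\Gamma}$ (depending on the gauge field) satisfying the Ginsparg–Wilson relation $\gamma_{d+1}D+D\gamma_{d+1}=D\gamma_{d+1}D$, transforming under lattice rotations, reflections and translations like the Wilson–Dirac operator (in particular $D(x,y)$ equals $D(x+z,y+z)$ for the shifted gauge field $U(x+z,\mu)$), and local: $\|D(x,y)\|\le C(1+\|x-y\|^p)e^{-\|x-y\|/\varrho}$ with constants $C,p$ and localization range $\varrho$. $D^\infty(x,y)$ is the corresponding operator on $\mathbb{Z}^d$ (the $L\to\infty$ limit), also satisfying the Ginsparg–Wilson relation, and the finite-size deviation obeys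 $\|D(x,x)-D^\infty(x,x)\|\le\kappa L^\nu e^{-L/\varrho}$ for $x\in{\Gamma}$, with constants $\kappa,\nu$. Axial anomalies: $\mathcal{A}(x)=\mathrm{tr}\,\gamma_{d+1}[1-\tfrac12D(x,x)]$ and $\mathcal{A}^\infty(x)=\mathrm{tr}\,\gamma_{d+1}[1-\tfrac12D^\infty(x,x)]$. As consequences of the Ginsparg–Wilson relation, $\sum_{x\in{\Gamma}}\mathcal{A}(x)=n_+-n_-$ (an integer, the index: $n_\pm$ are the numbers of zero modes of $\gamma_{d+1}D$ of chirality $\pm$). Standing fact on the infinite lattice: $\mathcal{A}^\infty(x)=q(x)+\partial^*_\mu k^\infty_\mu(x)$, where $k^\infty_\mu$ is a local, gauge invariant, translation invariant axial vector current (hence periodic on ${\Gamma}$ for periodic gauge fields), and $$q(x)=\frac{\mathcal{N}i^{d/2}}{(4\pi)^{d/2}(d/2)!}\epsilon_{\mu_1\nu_1\cdots\mu_{d/2}\nu_{d/2}}F_{\mu_1\nu_1}(x)F_{\mu_2\nu_2}(x+\hat\mu_1+\hat\nu_1)\cdots F_{\mu_{d/2}\nu_{d/2}}(x+\hat\mu_1+\hat\nu_1+\cdots+\hat\mu_{d/2-1}+\hat\nu_{d/2-1})$$ with an integer $\mathcal{N}$. *)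

(* Defs.v *)
(* MathComp + MathComp-Analysis (reals, expR, powR, pi, cos, sin,
   convergence of real sequences) + real-closed's complex numbers R[i]. *)
From mathcomp Require Import all_boot all_algebra.
From mathcomp Require Import boolp classical_sets reals topology normedtype
  sequences exp trigo.
From mathcomp.real_closed Require Import complex.
Import GRing.Theory Num.Theory.
Import ComplexField.
Import numFieldNormedType.Exports.

Set Implicit Arguments.
Unset Strict Implicit.
Unset Printing Implicit Defensive.

Local Open Scope classical_set_scope.
Local Open Scope complex_scope.
Local Open Scope ring_scope.

(* Lattice sites of Z^d, unit vectors, periodic lattice Gamma = {0..L-1}^d   *)

Definition site (d : nat) := {ffun 'I_d -> int}.

(* unit vector \hat mu *)
Definition uvec {d : nat} (mu : 'I_d) : site d := [ffun nu => (nu == mu)%:Z].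

(* the vector L \hat nu *)
Definition lvec {d : nat} (L : nat) (nu : 'I_d) : site d :=
  [ffun k => (L * (k == nu))%:Z].

(* x \in Gamma  <->  0 <= x_mu < L for all mu *)
Definition inG {d : nat} (L : nat) (x : site d) : Prop :=
  forall mu, (0 <= x mu)%R /\ (x mu < L%:Z)%R.

(* embedding of {0..L-1}^d into Z^d *)
Definition emb {d L : nat} (t : {ffun 'I_d -> 'I_L}) : site d :=
  [ffun mu => ((t mu : nat) : int)].

(* sum over Gamma *)
Definition sumG {d : nat} (L : nat) {V : nmodType} (f : site d -> V) : V :=
  \sum_(t : {ffun 'I_d -> 'I_L}) f (emb t).

(* sum over the box {-n..n}^d of Z^d *)
Definition sumBox {d : nat} (n : nat) {V : nmodType} (f : site d -> V) : V :=
  \sum_(t : {ffun 'I_d -> 'I_(n.*2.+1)}) f [ffun mu => ((t mu : nat) : int) - n%:Z].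

(* reduction of a site into Gamma (coordinatewise mod L) *)
Definition wrap {d : nat} (L : nat) (x : site d) : site d :=
  [ffun mu => ((x mu) %% (L%:Z))%Z].

(* Complex numbers                                                           *)

(* modulus of a complex number, as a real *)
Definition cabs {R : realType} (z : R[i]) : R :=
  Num.sqrt (complex.Re z ^+ 2 + complex.Im z ^+ 2).

(* principal argument in (-pi, pi] *)
Definition carg {R : realType} (z : R[i]) : R :=
  xget 0 [set t : R | (- pi < t /\ t <= pi) /\
                      complex.Re z = cabs z * cos t /\ complex.Im z = cabs z * sin t].

(* Gauge fields                                                              *)

(* a link field U(x,mu) on Z^d with complex values *)
Definition gfield (R : realType) (d : nat) := site d -> 'I_d -> R[i].

(* U(1)-valued *)
Definition U1field {R : realType} {d : nat} (U : gfield R d) : Prop :=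
  forall x mu, cabs (U x mu) = 1.

(* periodicity U(x + L nu, mu) = U(x, mu) *)
Definition periodicU {R : realType} {d : nat} (L : nat) (U : gfield R d) : Prop :=
  forall x mu nu, U (x + lvec L nu) mu = U x mu.

(* plaquette variable U(x,mu,nu) *)
Definition plaq {R : realType} {d : nat} (U : gfield R d) (x : site d)
    (mu nu : 'I_d) : R[i] :=
  U x mu * U (x + uvec mu) nu * (U (x + uvec nu) mu)^-1 * (U x nu)^-1.

(* F_{mu nu}(x) = ln U(x,mu,nu), with -pi < F/i <= pi *)
Definition Ffield {R : realType} {d : nat} (U : gfield R d) (x : site d)
    (mu nu : 'I_d) : R[i] :=
  'i * (carg (plaq U x mu nu))%:C.

(* admissibility with parameter eps *)
Definition admissible {R : realType} {d : nat} (eps : R) (U : gfield R d) : Prop :=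
  U1field U /\
  forall x mu nu, cabs (1 - plaq U x mu nu) < eps /\
                  `| carg (plaq U x mu nu) | < pi / 3%:R.

(* U(1) gauge transformations *)
Definition U1fun {R : realType} {d : nat} (Om : site d -> R[i]) : Prop :=
  forall x, cabs (Om x) = 1.

Definition periodic_fn {R : realType} {d : nat} (L : nat) (Om : site d -> R[i]) : Prop :=
  forall x nu, Om (x + lvec L nu) = Om x.

Definition gtrans {R : realType} {d : nat} (Om : site d -> R[i]) (U : gfield R d)
  : gfield R d :=
  fun x mu => Om x * U x mu * (Om (x + uvec mu))^-1.

(* shifted gauge field U(x+z,mu) *)
Definition tshift {R : realType} {d : nat} (z : site d) (U : gfield R d) : gfield R d :=
  fun x mu => U (x + z) mu.

(* Distances and norms                                                       *)

(* Euclidean norm on Z^d *)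
Definition enorm {R : realType} {d : nat} (x : site d) : R :=
  Num.sqrt (\sum_(mu < d) ((x mu)%:~R : R) ^+ 2).

(* squared periodic (torus) distance of one coordinate difference *)
Definition cdist2 {R : realType} (L : nat) (a : int) : R :=
  let r := (a %% L%:Z)%Z in
  ((if (r <= L%:Z - r)%R then r else L%:Z - r)%:~R : R) ^+ 2.

(* Euclidean distance on the periodic lattice Gamma *)
Definition tdist {R : realType} {d : nat} (L : nat) (x y : site d) : R :=
  Num.sqrt (\sum_(mu < d) cdist2 L (x mu - y mu)).

(* norm of a spinor matrix (Frobenius / Hilbert-Schmidt norm) *)
Definition mnorm {R : realType} {n : nat} (M : 'M[R[i]]_n) : R :=
  Num.sqrt (\sum_(i < n) \sum_(j < n) cabs (M i j) ^+ 2).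

(* Spinors, gamma matrices, Dirac operators                                  *)

(* spinor matrices: dimension 2^(d/2) *)
Definition spin (R : realType) (d : nat) := 'M[R[i]]_(2 ^ d./2).

(* hermitian Euclidean gamma matrices gamma_0 .. gamma_{d-1} *)
Definition clifford {R : realType} {d : nat} (gam : 'I_d -> spin R d) : Prop :=
  (forall mu nu, gam mu *m gam nu + gam nu *m gam mu =
                 ((mu == nu)%:R *+ 2) *: 1%:M) /\
  (forall mu, map_mx (fun z : R[i] => z^*) (gam mu)^T = gam mu).

(* gamma_{d+1} = i^{d/2} gamma_0 gamma_1 ... gamma_{d-1} *)
Definition chirality {R : realType} {d : nat} (gam : 'I_d -> spin R d) : spin R d :=
  ('i ^+ d./2) *: \prod_(mu < d) gam mu.

(* Dirac operator kernel D(x,y) for one gauge field *)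
Definition kernel (R : realType) (d : nat) := site d -> site d -> spin R d.

(* Ginsparg-Wilson relation on Gamma:
   g5 D + D g5 = D g5 D, products being operator products over Gamma *)
Definition GW_fin {R : realType} {d : nat} (L : nat) (g5 : spin R d)
    (Dm : kernel R d) : Prop :=
  forall x y, inG L x -> inG L y ->
    g5 *m Dm x y + Dm x y *m g5 = sumG L (fun z => Dm x z *m g5 *m Dm z y).

(* Ginsparg-Wilson relation on Z^d: the (absolutely convergent) sum over
   z in Z^d is the limit of sums over growing boxes {-n..n}^d *)
Definition GW_inf {R : realType} {d : nat} (g5 : spin R d) (Dm : kernel R d) : Prop :=
  forall x y (i j : 'I_(2 ^ d./2)),
    let u : nat -> R[i] := fun n => (sumBox n (fun z => Dm x z *m g5 *m Dm z y)) i j in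
    let l : R[i] := (g5 *m Dm x y + Dm x y *m g5) i j in
    ((fun n : nat => (complex.Re (u n) : R)) @ \oo --> (complex.Re l : R)) /\
    ((fun n : nat => (complex.Im (u n) : R)) @ \oo --> (complex.Im l : R)).

(* Standing assumptions on the finite-lattice operators D (one for each L),
   for admissible periodic gauge fields:
   Ginsparg-Wilson, gauge covariance, translation covariance, locality. *)
Definition finite_dirac_hyp {R : realType} {d : nat} (eps rho C : R) (p : nat)
    (g5 : spin R d) (D : nat -> gfield R d -> kernel R d) : Prop :=
  forall (L : nat) (U : gfield R d), admissible eps U -> periodicU L U ->
  [/\ GW_fin L g5 (D L U),
      (forall Om : site d -> R[i], U1fun Om -> periodic_fn L Om ->
         forall x y, inG L x -> inG L y ->
         D L (gtrans Om U) x y = (Om x * (Om y)^-1) *: D L U x y),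
      (forall z x y, inG L x -> inG L y ->
         D L (tshift z U) x y = D L U (wrap L (x + z)) (wrap L (y + z))) &
      (forall x y, inG L x -> inG L y ->
         mnorm (D L U x y) <=
           C * (1 + tdist L x y ^+ p) * expR (- tdist L x y / rho))].

(* Same assumptions for the infinite-lattice operator D^infty,
   for admissible gauge fields on Z^d *)
Definition infinite_dirac_hyp {R : realType} {d : nat} (eps rho C : R) (p : nat)
    (g5 : spin R d) (Dinf : gfield R d -> kernel R d) : Prop :=
  forall U : gfield R d, admissible eps U ->
  [/\ GW_inf g5 (Dinf U),
      (forall Om : site d -> R[i], U1fun Om ->
         forall x y, Dinf (gtrans Om U) x y = (Om x * (Om y)^-1) *: Dinf U x y),
      (forall z x y, Dinf (tshift z U) x y = Dinf U (x + z) (y + z)) &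
      (forall x y, mnorm (Dinf U x y) <=
           C * (1 + enorm (x - y) ^+ p) * expR (- enorm (x - y) / rho))].

(* finite-size deviation ||D(x,x) - D^infty(x,x)|| <= kappa L^nu e^{-L/rho},
   D^infty being evaluated on the periodic extension (which is U itself here) *)
Definition finite_size_hyp {R : realType} {d : nat} (eps rho kappa nu : R)
    (D : nat -> gfield R d -> kernel R d) (Dinf : gfield R d -> kernel R d) : Prop :=
  forall (L : nat) (U : gfield R d), admissible eps U -> periodicU L U ->
  forall x, inG L x ->
    mnorm (D L U x x - Dinf U x x) <= kappa * (L%:R `^ nu) * expR (- L%:R / rho).

(* Axial anomaly, topological density, divergence                           *)

(* A(x) = tr gamma_{d+1} [1 - D(x,x)/2] *)
Definition anomaly {R : realType} {d : nat} (g5 : spin R d) (Dxx : spin R d) : R[i] :=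
  \tr (g5 *m (1%:M - (2%:R)^-1 *: Dxx)).

(* backward divergence  partial^*_mu k_mu (x) *)
Definition divb {R : realType} {d : nat} (k : site d -> 'I_d -> R[i]) (x : site d)
  : R[i] :=
  \sum_(mu < d) (k x mu - k (x - uvec mu) mu).

(* Levi-Civita symbol of a sequence of indices (epsilon_{0 1 ... d-1} = 1):
   product over pairs i<j of sign(s_j - s_i) *)
Definition levi (s : seq nat) : int :=
  \prod_(i < size s) \prod_(j < size s | (i < j)%N)
     sgz ((nth 0%N s j)%:Z - (nth 0%N s i)%:Z).

(* q(x) = N i^{d/2} / ((4 pi)^{d/2} (d/2)!) eps_{mu1 nu1 ... } F_{mu1 nu1}(x)
          F_{mu2 nu2}(x + mu1 + nu1) ... ; an index tuple is t : 'I_(d/2) -> pairs *)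
Definition qdens {R : realType} {d : nat} (N : int) (U : gfield R d) (x : site d)
  : R[i] :=
  (N%:~R * 'i ^+ d./2 / (((4%:R * pi) ^+ d./2 * (d./2)`!%:R : R)%:C)) *
  \sum_(t : {ffun 'I_d./2 -> 'I_d * 'I_d})
     (levi (flatten [seq [:: val (t j).1; val (t j).2] | j <- enum 'I_d./2]))%:~R *
     \prod_(j < d./2)
        Ffield U (x + \sum_(l < d./2 | (l < j)%N) (uvec (t l).1 + uvec (t l).2))
               (t j).1 (t j).2.

(* Standing fact on the infinite lattice: A^infty = q + partial^* k^infty with
   k^infty local, gauge invariant and translation invariant *)
Definition standing_fact {R : realType} {d : nat} (eps : R) (N : int)
    (g5 : spin R d) (Dinf : gfield R d -> kernel R d)
    (kinf : gfield R d -> site d -> 'I_d -> R[i]) : Prop :=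
  [/\ (forall U, admissible eps U -> forall x,
         anomaly g5 (Dinf U x x) = qdens N U x + divb (kinf U) x),
      (forall U (Om : site d -> R[i]), admissible eps U -> U1fun Om ->
         kinf (gtrans Om U) = kinf U),
      (forall U z x mu, admissible eps U -> kinf (tshift z U) x mu = kinf U (x + z) mu) &
      (exists (C' rho' : R) (p' : nat), 0 < rho' /\
         forall U U' x mu (r : nat), admissible eps U -> admissible eps U' ->
           (forall y nu, enorm (y - x) <= (r%:R : R) -> U y nu = U' y nu) ->
           cabs (kinf U x mu - kinf U' x mu) <=
             C' * (1 + r%:R ^+ p') * expR (- r%:R / rho'))].

(* Main.v *)
From HB Require Import structures.
Require Import Defs.
From mathcomp Require Import all_boot all_order all_algebra.
From mathcomp Require Import ring lra.
From mathcomp Require Import boolp classical_sets reals topology normedtype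
  sequences exp trigo.
From mathcomp.real_closed Require Import complex.
Import Order.TTheory GRing.Theory Num.Theory.
Import ComplexField.
Import numFieldNormedType.Exports.
Local Open Scope classical_set_scope.
Local Open Scope complex_scope.
Local Open Scope ring_scope.

Set Implicit Arguments.
Unset Strict Implicit.
Unset Printing Implicit Defensive.

(* The difference A - A^oo is exponentially small, and its sum over Gamma is an
   integer: sum A is the trace of an average of two involutions, and sum A^oo is
   the lattice topological charge.  For large L the sum therefore vanishes, and a
   function of mean zero on the torus is a divergence, solved for explicitly by
   averaging over one direction at a time; the solution costs one power of L.

   The charge is integral because F / (2 pi i) is a closed 2-cochain (Bianchi, from
   |F| < pi/3) which is integer valued up to an exact one.  Averaging it over one
   direction changes it by an exact cochain, which by Stokes does not affect the sum
   of its cup power; the fully averaged cochain is constant, with entries in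
   L^-2 Z, so the charge is the Pfaffian of an integral matrix. *)

(** * Signs of index sequences *)

Lemma levi_cons (a : nat) (s : seq nat) :
  levi (a :: s) = (\prod_(b <- s) sgz (b%:Z - a%:Z)) * levi s.
Proof.
rewrite /levi /= big_ord_recl; congr (_ * _).
  rewrite big_mkcond big_ord_recl /= mul1r (big_nth 0%N) big_mkord.
  by [].
apply: eq_bigr => i _; rewrite big_mkcond big_ord_recl /= mul1r [RHS]big_mkcond.
by apply: eq_bigr => j _; rewrite /= /bump /= !add1n ltnS.
Qed.

Lemma levi_swap (s1 s2 : seq nat) (a b : nat) :
  levi (s1 ++ a :: b :: s2) = - levi (s1 ++ b :: a :: s2).
Proof.
elim: s1 => [|c s1 IH] /=.
  by rewrite !levi_cons !big_cons -(opprB a%:Z) sgzN; ring.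
rewrite !levi_cons IH mulrN; congr (- (_ * _)).
by apply: perm_big; rewrite perm_cat2l (perm_catCA [:: a] [:: b]).
Qed.

Lemma levi_moveR (s0 s1 s2 : seq nat) (a : nat) :
  levi (s0 ++ a :: s1 ++ s2) = (-1) ^+ size s1 * levi (s0 ++ s1 ++ a :: s2).
Proof.
elim: s1 s0 => [|b s1 IH] s0 /=; first by rewrite mul1r.
rewrite levi_swap; have := IH (rcons s0 b).
by rewrite !cat_rcons => ->; rewrite exprS -!mulrA mulN1r.
Qed.

(** * Antisymmetrized cup products and lattice exterior calculus *)

Section CupWords.
Variables (F : numFieldType) (d : nat) (T : zmodType) (e : 'I_d -> T).
Implicit Types (b : 'I_d -> T -> F) (f : 'I_d -> 'I_d -> T -> F) (s : seq nat).

Inductive cochain : Type :=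
  | C1 of ('I_d -> T -> F)
  | C2 of ('I_d -> 'I_d -> T -> F).

Definition cdeg c := match c with C1 _ => 1%N | C2 _ => 2%N end.

(* Path-ordered product of the cochains of [w] started at [x], antisymmetrized over
   all indices; [s] lists the indices already used. *)
Fixpoint cup (w : seq cochain) (s : seq nat) (x : T) : F :=
  match w with
  | [::] => (levi s)%:~R
  | C1 b :: w' => \sum_mu b mu x * cup w' (s ++ [:: val mu]) (x + e mu)
  | C2 f :: w' => \sum_mu \sum_nu f mu nu x *
        cup w' (s ++ [:: val mu; val nu]) (x + e mu + e nu)
  end.

Lemma cup_swap w s1 s2 (i j : nat) x :
  cup w (s1 ++ i :: j :: s2) x = - cup w (s1 ++ j :: i :: s2) x.
Proof.
elim: w s2 x => [|[b|f] w IH] s2 x /=.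
- by rewrite levi_swap rmorphN.
- rewrite -sumrN; apply: eq_bigr => mu _.
  by rewrite -!catA /= IH mulrN.
rewrite -sumrN; apply: eq_bigr => mu _; rewrite -sumrN; apply: eq_bigr => nu _.
by rewrite -!catA /= IH mulrN.
Qed.

Lemma cup_rot w s1 s2 (i j k : nat) x :
  cup w (s1 ++ i :: j :: k :: s2) x = cup w (s1 ++ j :: k :: i :: s2) x.
Proof.
rewrite cup_swap; have := cup_swap w (s1 ++ [:: j]) s2 i k x.
by rewrite -!catA /= => ->; rewrite opprK.
Qed.

Lemma cup_ctx u w w' : (forall s x, cup w s x = cup w' s x) ->
  forall s x, cup (u ++ w) s x = cup (u ++ w') s x.
Proof.
move=> H; elim: u => [|[b|f] u IH] s x //=.
- by apply: eq_bigr => mu _; rewrite IH.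
- by apply: eq_bigr => mu _; apply: eq_bigr => nu _; rewrite IH.
Qed.

(* [dop] is the operator [d = sum_mu T_mu] of noncommutative calculus: exterior
   differentiation is the graded commutator with it. *)
Definition dop : cochain := C1 (fun _ _ => 1).

(** For skew [f] this cyclic sum over pairs of opposite faces of a cube is [df = 0]. *)
Definition closed2 f := forall la mu nu x,
  (f mu nu (x + e la) - f mu nu x) + (f nu la (x + e mu) - f nu la x)
    + (f la mu (x + e nu) - f la mu x) = 0.

(** Both sides run over the same three index slots, and their difference is the forward difference
    of [f mu nu] along [la] times a tail [G]. Cyclic rotation of three indices is even and preserves
    the endpoint, so [G] is cyclically invariant. Hence three times the difference is the cyclic sum
    that closedness makes zero. *)
Lemma cup_closed f w s x : closed2 f ->
  cup [:: dop, C2 f & w] s x = cup [:: C2 f, dop & w] s x.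
Proof.
move=> cf /=.
pose G (la mu nu : 'I_d) : F := cup w (s ++ [:: val la; val mu; val nu]) (x + e la + e mu + e nu).
have GC la mu nu : G la mu nu = G mu nu la.
  rewrite /G cup_rot; congr (cup _ _ _).
  by rewrite -!addrA; congr (_ + _); rewrite addrC -addrA.
pose S (h : 'I_d -> 'I_d -> 'I_d -> F) := \sum_la \sum_mu \sum_nu h la mu nu.
have SC h : S h = S (fun la mu nu => h mu nu la).
  rewrite /S [RHS]exchange_big /=; apply: eq_bigr => i _.
  by rewrite [RHS]exchange_big.
have SD h h' : S h + S h' = S (fun la mu nu => h la mu nu + h' la mu nu).
  rewrite /S -big_split; apply: eq_bigr => i _ /=; rewrite -big_split.
  by apply: eq_bigr => j _ /=; rewrite -big_split.
have -> : \sum_la 1 * (\sum_mu \sum_nu f mu nu (x + e la) *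
     cup w ((s ++ [:: val la]) ++ [:: val mu; val nu]) (x + e la + e mu + e nu))
   = S (fun la mu nu => f mu nu (x + e la) * G la mu nu).
  apply: eq_bigr => la _; rewrite mul1r; apply: eq_bigr => mu _.
  by apply: eq_bigr => nu _; rewrite /G -catA.
have -> : \sum_mu \sum_nu f mu nu x * (\sum_la 1 *
     cup w ((s ++ [:: val mu; val nu]) ++ [:: val la]) (x + e mu + e nu + e la))
   = S (fun mu nu la => f mu nu x * G mu nu la).
  apply: eq_bigr => la _; apply: eq_bigr => mu _; rewrite mulr_sumr.
  by apply: eq_bigr => nu _; rewrite mul1r /G -catA.
rewrite [RHS]SC; apply/eqP; rewrite -subr_eq0.
have -> : S (fun la mu nu => f mu nu (x + e la) * G la mu nu)
   - S (fun la mu nu => f mu nu x * G mu nu la) =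
   S (fun la mu nu => (f mu nu (x + e la) - f mu nu x) * G la mu nu).
  rewrite /S -sumrB; apply: eq_bigr => i _ /=; rewrite -sumrB.
  apply: eq_bigr => j _ /=; rewrite -sumrB.
  by apply: eq_bigr => k _ /=; rewrite mulrBl [G i j k]GC.
set h := fun _ _ _ => _.
pose h1 la mu nu := h mu nu la; pose h2 la mu nu := h nu la mu.
have h1E : S h = S h1 := SC h; have h2E : S h = S h2 by rewrite h1E SC.
have : S h + S h1 + S h2 = 0.
  rewrite !SD /S.
  rewrite big1 // => i _; rewrite big1 // => j _; rewrite big1 // => k _.
  rewrite /h1 /h2 /h -(GC i j k) (GC k i j).
  by rewrite -!mulrDl -[RHS](mul0r (G i j k)) -(cf i j k x).
move/eqP; rewrite -h1E -h2E -mulr2n -mulrSr -mulr_natl mulf_eq0 pnatr_eq0.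
by [].
Qed.

Definition dcoch b : 'I_d -> 'I_d -> T -> F := fun mu nu x =>
  (b nu (x + e mu) - b nu x) - (b mu (x + e nu) - b mu x).

(** In degree one the graded commutator with [dop] is the anticommutator. The two halves of
    [dcoch e b] contribute equally under antisymmetrization, whence the factor 2. *)
Lemma cup_exact b w s x :
  cup (C2 (dcoch b) :: w) s x =
  2%:R * (cup [:: dop, C1 b & w] s x + cup [:: C1 b, dop & w] s x).
Proof.
rewrite /=.
pose G (mu nu : 'I_d) : F := cup w (s ++ [:: val mu; val nu]) (x + e mu + e nu).
have GC mu nu : G mu nu = - G nu mu.
  by rewrite /G cup_swap; congr (- cup _ _ _); rewrite addrAC.
pose S (h : 'I_d -> 'I_d -> F) := \sum_mu \sum_nu h mu nu.
have SC h : S h = S (fun mu nu => h nu mu) by rewrite /S exchange_big.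
have SD h h' : S h + S h' = S (fun la mu => h la mu + h' la mu).
  by rewrite /S -big_split; apply: eq_bigr => i _ /=; rewrite -big_split.
have -> : \sum_mu 1 * (\sum_nu b nu (x + e mu) *
     cup w ((s ++ [:: val mu]) ++ [:: val nu]) (x + e mu + e nu))
   = S (fun mu nu => b nu (x + e mu) * G mu nu).
  apply: eq_bigr => la _; rewrite mul1r; apply: eq_bigr => mu _.
  by rewrite /G -catA.
have -> : \sum_mu b mu x * (\sum_nu 1 *
     cup w ((s ++ [:: val mu]) ++ [:: val nu]) (x + e mu + e nu))
   = S (fun mu nu => b mu x * G mu nu).
  apply: eq_bigr => la _; rewrite mulr_sumr; apply: eq_bigr => nu _.
  by rewrite mul1r /G -catA.
have -> : \sum_mu \sum_nu dcoch b mu nu x *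
     cup w (s ++ [:: val mu; val nu]) (x + e mu + e nu) =
   S (fun mu nu => (b nu (x + e mu) - b nu x) * G mu nu) +
   S (fun mu nu => (b mu x - b mu (x + e nu)) * G mu nu).
  rewrite SD; apply: eq_bigr => i _; apply: eq_bigr => j _.
  by rewrite /dcoch -mulrDl opprB.
pose Y := S (fun mu nu => (b nu (x + e mu) - b nu x) * G mu nu).
have -> : S (fun mu nu => (b mu x - b mu (x + e nu)) * G mu nu) = Y.
  rewrite SC; apply: eq_bigr => i _; apply: eq_bigr => j _.
  by rewrite (GC j i) mulrN -mulNr opprB.
rewrite -/Y mulr_natl -mulr2n; congr (_ *+ _).
rewrite [X in _ = _ + X]SC SD; apply: eq_bigr => i _; apply: eq_bigr => j _.
by rewrite (GC j i) mulrN mulrBl.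
Qed.

Lemma cup_ctxD u w w1 w2 : (forall s x, cup w s x = cup w1 s x + cup w2 s x) ->
  forall s x, cup (u ++ w) s x = cup (u ++ w1) s x + cup (u ++ w2) s x.
Proof.
move=> H; elim: u => [|[b|f] u IH] s x //=.
  by rewrite -big_split; apply: eq_bigr => mu _; rewrite IH mulrDr.
rewrite -big_split; apply: eq_bigr => mu _ /=; rewrite -big_split.
by apply: eq_bigr => nu _; rewrite IH mulrDr.
Qed.

Definition wdeg w := sumn (map cdeg w).

(** A trailing [dop] carries no field value, and nothing is evaluated after its shift, so only its
    index remains. Bringing that index to the front of the Levi-Civita symbol passes all the others
    and produces the sign. *)
Lemma cup_rcons_one w s x :
  cup (rcons w dop) s x =
  (-1) ^+ (wdeg w + size s) * \sum_(la < d) cup w (val la :: s) x.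
Proof.
elim: w s x => [|[b|f] w IH] s x /=.
- rewrite mulr_sumr; apply: eq_bigr => la _; rewrite mul1r.
  have := levi_moveR [::] s [::] (val la); rewrite /= cats0 => ->.
  by rewrite rmorphM rmorphXn rmorphN1 mulrA -expr2 sqrr_sign mul1r.
- under eq_bigr do rewrite IH mulrCA size_cat /= addn1 addnS.
  rewrite -mulr_sumr; congr (_ * _).
  rewrite [RHS]exchange_big; apply: eq_bigr => mu _ /=.
  by rewrite mulr_sumr.
under eq_bigr => mu _ do under eq_bigr do rewrite IH mulrCA size_cat /= addn2 !addnS.
under eq_bigr do rewrite -mulr_sumr.
rewrite -mulr_sumr; congr (_ * _).
rewrite [RHS]exchange_big; apply: eq_bigr => mu _ /=.
rewrite [RHS]exchange_big; apply: eq_bigr => nu _ /=.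
by rewrite mulr_sumr.
Qed.

End CupWords.

(** * Stokes' theorem on a finite group *)

Section Stokes.
Variables (F : numFieldType) (d : nat) (T : finZmodType) (e : 'I_d -> T).
Local Notation cup := (@cup F d T e).
Local Notation dop := (@dop F d T).

Lemma sum_shift (G : T -> F) (v : T) : \sum_x G (x + v) = \sum_x G x.
Proof. by rewrite [RHS](reindex_inj (addIr v)). Qed.

(** Summation over [T] is a graded trace: a leading [dop] inserts an index and a shift, which the
    sum absorbs. A trailing one inserts the same index with sign -1, as [w] is odd. *)
Lemma cup_trace w : odd (wdeg w) ->
  \sum_x cup (dop :: w) [::] x + \sum_x cup (rcons w dop) [::] x = 0.
Proof.
move=> ow; under [X in _ + X]eq_bigr do rewrite cup_rcons_one addn0 -signr_odd ow mulN1r.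
rewrite sumrN /= [X in X - _]exchange_big [X in _ - X]exchange_big /= -sumrB.
rewrite big1 // => la _; under eq_bigr do rewrite mul1r.
by rewrite (sum_shift (fun x => cup w [:: val la] x)) subrr.
Qed.

Lemma cup_one_closed k f w s x : closed2 e f ->
  cup (dop :: nseq k (C2 f) ++ w) s x = cup (nseq k (C2 f) ++ dop :: w) s x.
Proof.
move=> cf; elim: k s x => [//|k IH] s x.
rewrite [LHS]cup_closed //.
by rewrite [nseq _ _]/= ; apply: (@cup_ctx _ _ _ e [:: C2 f]) => s' x'; rewrite -IH.
Qed.

Lemma wdeg_C1 i k f f' b :
  odd (wdeg (nseq i (C2 f) ++ C1 b :: nseq k (C2 f') : seq (cochain F d T))).
Proof.
rewrite /wdeg map_cat sumn_cat /= oddD /= !map_nseq !sumn_nseq /=.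
by rewrite !oddM.
Qed.

(** Expanding the exact factor puts [dop] on either side of [b]. It commutes with the closed
    factors, so it can be carried to the two ends of the word, where the trace identity cancels both
    terms. *)
Lemma cup_exact_sum i k f f' b : closed2 e f -> closed2 e f' ->
  \sum_x cup (nseq i (C2 f) ++ C2 (dcoch e b) :: nseq k (C2 f')) [::] x = 0.
Proof.
move=> cf cf'.
have H x : cup (nseq i (C2 f) ++ C2 (dcoch e b) :: nseq k (C2 f')) [::] x =
   2%:R * (cup (dop :: nseq i (C2 f) ++ C1 b :: nseq k (C2 f')) [::] x
           + cup (rcons (nseq i (C2 f) ++ C1 b :: nseq k (C2 f')) dop) [::] x).
  rewrite cup_one_closed // -cats1 -catA /=.
  have -> : cup (nseq i (C2 f) ++ C1 b :: nseq k (C2 f') ++ [:: dop]) [::] x =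
     cup (nseq i (C2 f) ++ [:: C1 b, dop & nseq k (C2 f')]) [::] x.
    apply: cup_ctx => s' x'; apply: (@cup_ctx _ _ _ e [:: C1 b]) => s'' x''.
    by rewrite -cup_one_closed // cats0.
  elim: i [::] x => [|i IH] s x; first by rewrite cup_exact.
  rewrite /= -big_split mulr_sumr; apply: eq_bigr => mu _ /=.
  rewrite -big_split mulr_sumr; apply: eq_bigr => nu _ /=.
  by rewrite IH -mulrDr mulrCA.
under eq_bigr do rewrite H.
rewrite -mulr_sumr big_split -[RHS](mulr0 2%:R); congr (_ * _).
exact: cup_trace (wdeg_C1 i k f f' b).
Qed.

Lemma cup_pow_cohomologous m f f' b : closed2 e f -> closed2 e f' ->
  (forall mu nu x, f mu nu x = f' mu nu x + dcoch e b mu nu x) ->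
  \sum_x cup (nseq m (C2 f)) [::] x = \sum_x cup (nseq m (C2 f')) [::] x.
Proof.
move=> cf cf' ff'.
(* The factors [f] are exchanged for [f'] one at a time, the rightmost first; each exchange leaves a
   word with one exact factor, whose sum vanishes. *)
have H i k : \sum_x cup (nseq i (C2 f) ++ nseq k (C2 f')) [::] x
           = \sum_x cup (nseq (i + k) (C2 f')) [::] x.
  elim: i k => [//|i IH] k; rewrite addSnnS -IH.
  have E x : cup (nseq i.+1 (C2 f) ++ nseq k (C2 f')) [::] x =
      cup (nseq i (C2 f) ++ nseq k.+1 (C2 f')) [::] x +
      cup (nseq i (C2 f) ++ C2 (dcoch e b) :: nseq k (C2 f')) [::] x.
    rewrite -addn1 nseqD -catA; apply: cup_ctxD => s y.
    rewrite /= -big_split; apply: eq_bigr => mu _; rewrite -big_split.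
    by apply: eq_bigr => nu _; rewrite ff' mulrDl.
  under eq_bigr do rewrite E.
  by rewrite big_split /= cup_exact_sum // addr0.
by have := H m 0%N; rewrite addn0 cats0.
Qed.

End Stokes.

(** * Averages along a direction and their explicit primitives *)

Section Averages.
Variables (F : numFieldType) (T : zmodType) (L : nat) (L_gt0 : (0 < L)%N).
Implicit Types (f g : T -> F) (v x z : T).

Definition avg v f x : F := L%:R^-1 * \sum_(j < L) f (x - v *+ j).

(* The weights are chosen so that the backward difference along [v] telescopes
   to [f - avg v f], with no condition on the order of [v]. *)
Definition prim v f x : F := \sum_(j < L) (1 - j.+1%:R / L%:R) * f (x - v *+ j).

Let L_neq0 : L%:R != 0 :> F. Proof. by rewrite pnatr_eq0 -lt0n. Qed.

Lemma prim_diff v f x : prim v f x - prim v f (x - v) = f x - avg v f x.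
Proof.
rewrite /prim /avg; pose g j := f (x - v *+ j).
have gS j : f (x - v - v *+ j) = g j.+1.
  by rewrite /g mulrS opprD addrA.
rewrite -sumrB.
(* Summation by parts leaves a boundary term of weight [1 - n / L], which vanishes at [n = L]. *)
have H n : \sum_(j < n) ((1 - j.+1%:R / L%:R) * f (x - v *+ j)
      - (1 - j.+1%:R / L%:R) * f (x - v - v *+ j)) =
    g 0%N - L%:R^-1 * (\sum_(j < n) g j) - (1 - n%:R / L%:R) * g n.
  elim: n => [|n IH]; first by rewrite !big_ord0; ring.
  by rewrite big_ord_recr /= IH big_ord_recr /= gS -/(g n) -[n.+1]addn1 natrD; ring.
by rewrite H divff // subrr mul0r subr0 /g mulr0n subr0.
Qed.

Lemma eq_avg v f g : f =1 g -> avg v f =1 avg v g.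
Proof. by move=> fg x; congr (_ * _); apply: eq_bigr => j _; rewrite fg. Qed.

Lemma avgB v f g x : avg v (fun y => f y - g y) x = avg v f x - avg v g x.
Proof. by rewrite /avg sumrB mulrBr. Qed.

Lemma avg_shift v f z x : avg v (fun y => f (y + z)) x = avg v f (x + z).
Proof. by congr (_ * _); apply: eq_bigr => j _; rewrite addrAC. Qed.

Lemma prim_shift v f z x : prim v (fun y => f (y + z)) x = prim v f (x + z).
Proof. by apply: eq_bigr => j _; rewrite addrAC. Qed.

Lemma avg_per v f x : v *+ L = 0 -> avg v f (x + v) = avg v f x.
Proof.
move=> vL; congr (_ * _); case: L vL => [|n] vL; first by rewrite !big_ord0.
rewrite big_ord_recl big_ord_recr /= addrC; congr (_ + _).
  by congr f; rewrite mulr0n subr0 -[LHS]subr0 -vL mulrS opprD !addrA addrK.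
by apply: eq_bigr => j _; congr f; rewrite /= /bump /= add1n mulrS opprD addrA addrK.
Qed.

Lemma norm_avg v f B : (forall x, `|f x| <= B) -> forall x, `|avg v f x| <= B.
Proof.
move=> fB x; rewrite /avg normrM normfV normr_nat mulrC ler_pdivrMr ?ltr0n //.
apply: le_trans (ler_norm_sum _ _ _) _.
apply: (@le_trans _ _ (\sum_(j < L) B)); first exact: ler_sum.
by rewrite sumr_const card_ord mulr_natr.
Qed.

(** The [L] weights all lie in [[0, 1]]; this is where one power of [L] is lost. *)
Lemma norm_prim v f B : (forall x, `|f x| <= B) ->
  forall x, `|prim v f x| <= L%:R * B.
Proof.
move=> fB x; apply: le_trans (ler_norm_sum _ _ _) _.
apply: (@le_trans _ _ (\sum_(j < L) B)); last by rewrite sumr_const card_ord mulr_natl.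
apply: ler_sum => j _; rewrite normrM -[B]mul1r ler_pM //.
rewrite ger0_norm ?subr_ge0 ?ler_pdivrMr ?ltr0n // ?mul1r ?ler_nat //.
by rewrite gerBl divr_ge0.
Qed.

Variable ev : nat -> T.

Fixpoint avgs n f : T -> F := if n is k.+1 then avg (ev k) (avgs k f) else f.

Lemma avgs_tele n f x : f x - avgs n f x =
  \sum_(i < n) (prim (ev i) (avgs i f) x - prim (ev i) (avgs i f) (x - ev i)).
Proof.
elim: n => [|n IH]; first by rewrite big_ord0 subrr.
by rewrite big_ord_recr /= -IH prim_diff addrA subrK.
Qed.

Lemma norm_avgs n f B : (forall x, `|f x| <= B) -> forall x, `|avgs n f x| <= B.
Proof. by move=> fB; elim: n => [//|n IH] x /=; exact: norm_avg. Qed.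

Lemma avgs_per n f i x : (i < n)%N -> (forall j, (j < n)%N -> ev j *+ L = 0) ->
  avgs n f (x + ev i) = avgs n f x.
Proof.
elim: n x => [//|n IH] x; rewrite ltnS leq_eqVlt => /orP[/eqP->|lt_in] evL /=.
  by rewrite avg_per // evL.
rewrite -avg_shift; apply: eq_avg => y; apply: IH => // j lt_jn.
by apply: evL; rewrite ltnW.
Qed.

End Averages.

(** * Divergence equation, cohomology by averaging, and quantized fluxes *)

Section TorusAverages.
Variables (F : numFieldType) (T : finZmodType) (L d : nat) (L_gt0 : (0 < L)%N).
Variable ev : nat -> T.
Hypothesis evL : forall i, ev i *+ L = 0.
Hypothesis gen : forall f : T -> F, (forall (i : 'I_d) x, f (x + ev i) = f x) ->
  forall x y, f x = f y.
Local Notation e := (fun i : 'I_d => ev i).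
Implicit Types (h : T -> F) (f : 'I_d -> 'I_d -> T -> F).

Lemma sum_avg v h : \sum_x avg L v h x = \sum_x h x.
Proof.
rewrite -mulr_sumr exchange_big /=.
under eq_bigr do rewrite (sum_shift h).
by rewrite sumr_const card_ord -[X in _ * X]mulr_natl mulrA mulVf ?mul1r // pnatr_eq0 -lt0n.
Qed.

Lemma sum_avgs n h : \sum_x avgs L ev n h x = \sum_x h x.
Proof. by elim: n => [//|n IH]; rewrite -IH -[RHS](sum_avg (ev n)). Qed.

Lemma avgs_const h x y : avgs L ev d h x = avgs L ev d h y.
Proof. by apply: gen => i z; apply: avgs_per => // j _; apply: evL. Qed.

Lemma const_sum h k : (forall x y, h x = h y) -> \sum_x h x = \sum_x k x ->
  (forall x y, k x = k y) -> forall x, h x = k x.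
Proof.
move=> hc hk kc x; move: hk.
rewrite (eq_bigr (fun=> h x)) // [RHS](eq_bigr (fun=> k x)) // !sumr_const.
by apply: pmulrnI; apply/card_gt0P; exists x.
Qed.

(** The average over all [d] directions is constant with the same sum as [h], hence zero.
    Telescoping over the successive averages then exhibits [h] as a divergence. *)
Lemma poisson h : \sum_x h x = 0 -> forall x,
  h x = \sum_(i < d) (prim L (ev i) (avgs L ev i h) x - prim L (ev i) (avgs L ev i h) (x - ev i)).
Proof.
move=> h0 x; rewrite -avgs_tele // (@const_sum (avgs L ev d h) (fun=> 0)) ?subr0 //.
  exact: avgs_const.
by rewrite sum_avgs h0 big1.
Qed.

Definition skew2 f := forall mu nu x, f mu nu x = - f nu mu x.

Lemma closed2_avg v f : closed2 e f -> closed2 e (fun mu nu => avg L v (f mu nu)).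
Proof.
move=> cf la mu nu x; rewrite /= -!avg_shift -!avgB /avg -!mulrDr -!big_split /=.
by rewrite big1 ?mulr0 // => j _; apply: cf.
Qed.

Lemma skew_avg v f : skew2 f -> skew2 (fun mu nu => avg L v (f mu nu)).
Proof.
move=> sf mu nu x; rewrite -mulrN -sumrN; congr (_ * _).
by apply: eq_bigr => j _; apply: sf.
Qed.

(** The homotopy contracts [f] with the direction [la] and takes the primitive along it. Closedness
    turns the coboundary of [prim (f la mu)] into the difference along [la] of [prim (f mu nu)],
    which is [f] minus its average. The shift by [- ev la] turns forward differences into backward
    ones. *)
Lemma avg_cohomologous (la : 'I_d) f : closed2 e f -> skew2 f ->
  exists b, forall mu nu x,
    f mu nu x = avg L (ev la) (f mu nu) x + dcoch e b mu nu x.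
Proof.
move=> cf sf; exists (fun mu x => prim L (ev la) (f la mu) (x - ev la)) => mu nu x.
apply/eqP; rewrite addrC -subr_eq -prim_diff // /dcoch; apply/eqP.
rewrite -{1}[x](subrK (ev la)) -prim_shift !(addrAC _ _ (- ev la)).
rewrite -[prim _ _ _ (x - ev la + ev mu)]prim_shift.
rewrite -[prim _ _ _ (x - ev la + ev nu)]prim_shift.
rewrite /prim -!sumrB; apply: eq_bigr => j _.
rewrite -!mulrBr; congr (_ * _).
have := cf la mu nu (x - ev la - ev la *+ j); rewrite (sf nu la) (sf nu la _) /=.
move=> H; apply/eqP; rewrite -subr_eq0 -{}H; apply/eqP; ring.
Qed.

Lemma cup_pow_avgs m n f : (n <= d)%N -> closed2 e f -> skew2 f ->
  \sum_x cup e (nseq m (C2 f)) [::] x =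
  \sum_x cup e (nseq m (C2 (fun mu nu => avgs L ev n (f mu nu)))) [::] x.
Proof.
move=> + cf sf; elim: n => [//|n IH] lt_nd; rewrite IH ?(ltnW lt_nd) //.
have [cg sg] : closed2 e (fun mu nu => avgs L ev n (f mu nu)) /\
    skew2 (fun mu nu => avgs L ev n (f mu nu)).
  by elim: (n) => [//|k [c s]]; split; [exact: closed2_avg | exact: skew_avg].
have [b Hb] := avg_cohomologous (Ordinal lt_nd) cg sg.
exact: (cup_pow_cohomologous m cg (closed2_avg (ev n) cg) Hb).
Qed.

Lemma avg_diff v h x : v *+ L = 0 -> avg L v (fun y => h (y + v) - h y) x = 0.
Proof. by move=> vL; rewrite avgB avg_shift avg_per // subrr. Qed.

Lemma avgC v w h x : avg L v (avg L w h) x = avg L w (avg L v h) x.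
Proof.
rewrite /avg -!mulr_sumr exchange_big /=; congr (_ * (_ * _)).
by apply: eq_bigr => i _; apply: eq_bigr => j _; rewrite addrAC.
Qed.

(** Each of the two terms of [dcoch] is a difference along [mu] or along [nu], and averaging in that
    same direction kills it. *)
Lemma avg2_dcoch (a : 'I_d -> T -> F) (mu nu : 'I_d) x :
  avg L (ev mu) (avg L (ev nu) (dcoch e a mu nu)) x = 0.
Proof.
rewrite (@eq_avg F T L _ _ (fun y => avg L (ev nu) (fun z => a nu (z + ev mu) - a nu z) y - 0)).
  rewrite avgB avgC (@eq_avg F T L _ _ ( fun=> 0)); last by move=> y; rewrite avg_diff.
  by rewrite /avg !big1 ?mulr0 ?subr0 // => ? _; rewrite ?big1 ?mulr0.
move=> y; rewrite -(avg_diff (a mu) y (evL nu)) -avgB.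
by apply: eq_avg.
Qed.

(** The average over the plane of [mu] and [nu] is already constant: by closedness its increment
    along [la] is the plane average of an exact cochain, which vanishes. It therefore equals the
    full average. The exact part of [f] drops out of it as well, leaving [L ^ -2] times a sum of
    integers over the plane. *)
Lemma flux_integral f a (n : 'I_d -> 'I_d -> T -> int) : closed2 e f -> skew2 f ->
  (forall mu nu x, f mu nu x = dcoch e a mu nu x + (n mu nu x)%:~R) ->
  forall mu nu x, exists k : int, L%:R ^+ 2 * avgs L ev d (f mu nu) x = k%:~R.
Proof.
move=> cf sf fE mu nu x.
rewrite (@const_sum _ (avg L (ev mu) (avg L (ev nu) (f mu nu)))); last 3 first.
- exact: avgs_const.
- by rewrite sum_avgs !sum_avg.
- apply: gen => la y; apply/eqP; rewrite -subr_eq0 -avg_shift -avgB.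
  rewrite -[X in _ == X](avg2_dcoch (fun ka => f la ka) mu nu y); apply/eqP.
  apply: eq_avg => z; rewrite -avg_shift -avgB; apply: eq_avg => {}z.
  have := cf la mu nu z; rewrite (sf nu la) (sf nu la z) /dcoch => H.
  by apply/eqP; rewrite -subr_eq0 -{}H; apply/eqP; ring.
exists (\sum_(i < L) \sum_(j < L) n mu nu (x - ev mu *+ i - ev nu *+ j)).
have L0 : L%:R != 0 :> F by rewrite pnatr_eq0 -lt0n.
rewrite rmorph_sum /=.
have -> : avg L (ev mu) (avg L (ev nu) (f mu nu)) x =
   avg L (ev mu) (avg L (ev nu) (fun y => (n mu nu y)%:~R)) x.
  apply/eqP; rewrite -subr_eq0 -avgB -[X in _ == X](avg2_dcoch a mu nu x); apply/eqP.
  apply: eq_avg => z; rewrite -avgB; apply: eq_avg => {}z.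
  by rewrite fE addrK.
rewrite /avg -mulr_sumr.
rewrite -(eq_bigr _ (fun i _ => esym (rmorph_sum _ _ _ _))) /=.
by rewrite !mulrA expr2 mulfK // divff // mul1r.
Qed.

End TorusAverages.

(** * Cup powers of constant cochains and the Pfaffian *)

Lemma big_ffun_recl (V : nmodType) (X : finType) k (G : {ffun 'I_k.+1 -> X} -> V) :
  \sum_t G t = \sum_p \sum_(t : {ffun 'I_k -> X})
     G [ffun j => if unlift ord0 j is Some i then t i else p].
Proof.
pose h (q : X * {ffun 'I_k -> X}) : {ffun 'I_k.+1 -> X} :=
  [ffun j => if unlift ord0 j is Some i then q.2 i else q.1].
rewrite (reindex h); first by rewrite pair_bigA.
exists (fun t : {ffun 'I_k.+1 -> X} => (t ord0, [ffun i : 'I_k => t (lift ord0 i)]))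
  => [[p t] _|t _] /=.
  rewrite /h !ffunE unlift_none /=; congr (_, _).
  by apply/ffunP => i; rewrite !ffunE /= liftK.
apply/ffunP => j; rewrite !ffunE /=.
by case: unliftP => [i|] ->; rewrite ?ffunE.
Qed.

Definition indices d (s : seq ('I_d * 'I_d)) : seq nat :=
  flatten [seq [:: val p.1; val p.2] | p <- s].

(** Unfolds the recursion into a sum over tuples of index pairs, the shape in which [qdens] is
    written. *)
Lemma cup_powE (F : numFieldType) d (T : zmodType) (e : 'I_d -> T) f k s x :
  cup (F := F) e (nseq k (C2 f)) s x =
  \sum_(t : {ffun 'I_k -> 'I_d * 'I_d})
     (levi (s ++ indices [seq t j | j <- enum 'I_k]))%:~R *
     \prod_(j < k) f (t j).1 (t j).2
       (x + \sum_(l < k | (l < j)%N) (e (t l).1 + e (t l).2)).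
Proof.
elim: k s x => [|k IH] s x /=.
  rewrite (eq_bigr (fun=> (levi s)%:~R)) => [|t _]; last first.
    by rewrite big_ord0 mulr1 (size0nil (size_enum_ord 0)) cats0.
  by rewrite sumr_const card_ffun card_ord expn0.
rewrite big_ffun_recl pair_bigA /=; apply: eq_bigr => p _.
rewrite IH mulr_sumr; apply: eq_bigr => t _.
rewrite big_ord_recl /= ffunE unlift_none [\sum_(l < k.+1 | (l < 0)%N) _]big_pred0 // addr0.
rewrite mulrCA; congr (_ * (_ * _)).
  congr (levi _)%:~R; rewrite -catA; congr (_ ++ _).
  rewrite enum_ordSl /indices /= ffunE unlift_none; do 2 congr (_ :: _).
  congr flatten; rewrite -!map_comp; apply: eq_map => i /=.
  by rewrite ffunE liftK.
apply: eq_bigr => j _; rewrite ffunE liftK; congr (f _ _ _).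
rewrite [in RHS]big_mkcond [in RHS]big_ord_recl /= ffunE unlift_none !addrA.
congr (_ + _); rewrite big_mkcond; apply: eq_bigr => l _.
by rewrite !ffunE liftK /= /bump /= !add1n ltnS.
Qed.

(** Pairs are blocks of even length, so permuting them is an even permutation of the indices. *)
Lemma levi_perm d (s s' : seq ('I_d * 'I_d)) s0 : perm_eq s s' ->
  levi (s0 ++ indices s) = levi (s0 ++ indices s').
Proof.
elim: s s' s0 => [|p s IH] s' s0; first by move/perm_size/esym/size0nil->.
move=> ps; have ps' : p \in s' by rewrite -(perm_mem ps) mem_head.
move: ps; case/splitPr: ps' => s1 s2; rewrite (perm_sym _ (_ ++ _)) => ps.
have {}ps : perm_eq s (s1 ++ s2).
  by rewrite -(perm_cons p) perm_sym -(perm_catCA s1 [:: p]).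
rewrite /indices /= -[s0 ++ _]/(s0 ++ [:: val p.1; val p.2] ++ indices s) catA (IH _ _ ps) -catA /=.
have -> : indices (s1 ++ s2) = indices s1 ++ indices s2.
  by rewrite /indices map_cat flatten_cat.
rewrite map_cat flatten_cat /= -/(indices s1) -/(indices s2).
have ev : (-1) ^+ size (indices s1) = 1 :> int.
  rewrite -signr_odd; suff -> : odd (size (indices s1)) = false by [].
  by elim: s1 {ps} => //= q s1 ->.
have := levi_moveR (s0 ++ [:: val p.1]) (indices s1) (indices s2) (val p.2).
rewrite -!catA /= => ->; rewrite ev mul1r.
have := levi_moveR s0 (indices s1) (val p.2 :: indices s2) (val p.1).
by rewrite ev mul1r.
Qed.

Lemma levi_dup d (s : seq ('I_d * 'I_d)) : ~~ uniq s -> levi (indices s) = 0.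
Proof.
elim: s => [//|p s IH] /=; rewrite negb_and negbK => /orP[ps|/IH s0]; last first.
  by rewrite /indices /= !levi_cons -/(indices s) s0 !mulr0.
rewrite /indices /= levi_cons big_cons; set P := \prod_(b <- _) _.
suff -> : P = 0 by rewrite mulr0 mul0r.
have pin : val p.1 \in indices s; last first.
  by rewrite /P (big_rem _ pin) /= subrr sgz0 mul0r.
by apply/flattenP; exists [:: val p.1; val p.2]; rewrite ?mem_head //; apply/mapP; exists p.
Qed.

(** Only injective tuples contribute. Grouped by image, each set of [m] elements comes from [m!]
    tuples, all with the same value of [g]. *)
Lemma fact_dvd_sum (X : finType) m (g : seq X -> int) :
  (forall s s', perm_eq s s' -> g s = g s') -> (forall s, ~~ uniq s -> g s = 0) ->
  exists z : int, \sum_(t : {ffun 'I_m -> X}) g [seq t j | j <- enum 'I_m] = z * (m`!)%:Z.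
Proof.
move=> gp gu; pose im (t : {ffun 'I_m -> X}) : {set X} := t @: 'I_m.
rewrite (bigID (fun t : {ffun 'I_m -> X} => injectiveb t)) /=.
rewrite [X in _ + X]big1 => [|t nt]; last first.
  by apply: gu; apply: contra nt; rewrite /injectiveb /dinjectiveb.
rewrite addr0 (partition_big im predT) //=.
exists (\sum_(S : {set X} | #|S| == m) g (enum S)).
rewrite (bigID (fun S : {set X} => #|S| == m)) /= [X in _ + X]big1 => [|S nS]; last first.
  rewrite big1 // => t /andP[/injectiveP ti /eqP tS]; case/negP: nS.
  by rewrite -tS card_imset // card_ord.
rewrite addr0 mulr_suml; apply: eq_bigr => S /eqP cS.
rewrite (eq_bigr (fun=> g (enum S))) => [|t /andP[ti /eqP tS]]; last first.
  apply: gp; apply: uniq_perm; rewrite ?enum_uniq //.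
  move=> y; rewrite mem_enum -tS; apply/mapP/imsetP => -[j _ ->]; exists j => //.
  by rewrite mem_enum.
rewrite sumr_const -mulr_natr natz; congr (_ * Posz _).
have -> : m`! = (#|S| ^_ #|'I_m|)%N by rewrite cS card_ord ffactnn.
rewrite -card_inj_ffuns_on; apply: eq_card => t; rewrite !inE [RHS]andbC.
rewrite unfold_in; apply: andb_id2l => ti.
apply/eqP/forallP => [<- j|tS]; first exact: imset_f.
apply/eqP; rewrite eqEcard cS card_imset ?card_ord ?leqnn ?andbT; last exact/injectiveP.
by apply/fintype.subsetP => _ /imsetP[j _ ->].
Qed.

(** In every slot, antisymmetrization makes [A] and minus its transpose contribute equally, which
    gives one factor 2 per slot. *)
Lemma cup_pow_const2 (F : numFieldType) d (T : zmodType) (e : 'I_d -> T)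
    (A : 'I_d -> 'I_d -> F) k s x :
  cup e (nseq k (C2 (fun mu nu _ => A mu nu - A nu mu))) s x =
  2%:R ^+ k * cup e (nseq k (C2 (fun mu nu _ => A mu nu))) s x.
Proof.
elim: k s x => [|k IH] s x /=; first by rewrite mul1r.
pose G (mu nu : 'I_d) := cup e (nseq k (C2 (fun mu nu _ => A mu nu)))
  (s ++ [:: val mu; val nu]) (x + e mu + e nu).
have GC mu nu : G nu mu = - G mu nu by rewrite /G cup_swap (addrAC x (e nu)).
pose Y := \sum_mu \sum_nu A mu nu * G mu nu.
transitivity (2%:R ^+ k * (Y + Y)); last by rewrite -mulr2n exprSr -mulrA mulr_natl.
have {2}-> : Y = \sum_mu \sum_nu A nu mu * G nu mu by rewrite /Y exchange_big.
rewrite -big_split mulr_sumr; apply: eq_bigr => mu _.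
rewrite -big_split mulr_sumr; apply: eq_bigr => nu _ /=.
by rewrite IH -/(G mu nu) (GC mu nu) mulrN -mulrBl mulrCA.
Qed.

(* The cup power of a constant skew cochain [M] is [2^k k!] times its Pfaffian. *)
Lemma pfaffian_integral (F : numFieldType) d (T : zmodType) (e : 'I_d -> T)
    (M : 'I_d -> 'I_d -> int) k x : (forall mu nu, M mu nu = - M nu mu) ->
  exists z : int, cup (F := F) e (nseq k (C2 (fun mu nu _ => (M mu nu)%:~R))) [::] x
     = (z * (2 ^ k * k`!)%:Z)%:~R.
Proof.
(* With [A] the upper triangle, [M] is [A] minus its transpose, which yields [2 ^ k]; the factorial
   comes from permuting the pairs. *)
move=> Mskew; pose A (mu nu : 'I_d) : int := if (mu < nu)%N then M mu nu else 0.
have MA mu nu : M mu nu = A mu nu - A nu mu.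
  rewrite /A; case: ltngtP => [_|_|/val_inj ->]; rewrite ?subr0 ?sub0r //.
  have /eqP := Mskew nu nu; rewrite -subr_eq0 opprK -mulr2n mulrn_eq0 /=.
  by move/eqP.
pose g (s : seq ('I_d * 'I_d)) : int := levi (indices s) * \prod_(p <- s) A p.1 p.2.
have [z zE] : exists z : int, \sum_(t : {ffun 'I_k -> 'I_d * 'I_d})
    g [seq t j | j <- enum 'I_k] = z * (k`!)%:Z.
  apply: fact_dvd_sum => [s s' ss'|s us]; last by rewrite /g levi_dup ?mul0r.
  rewrite /g (perm_big _ ss'); congr (_ * _); exact: (levi_perm [::] ss').
exists z; have := cup_pow_const2 e (fun mu nu => (A mu nu)%:~R : F) k [::] x.
have -> : cup e (nseq k (C2 (fun mu nu _ => (M mu nu)%:~R))) [::] x =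
  cup e (nseq k (C2 (fun mu nu _ => (A mu nu)%:~R - (A nu mu)%:~R : F))) [::] x.
  elim: k [::] x {zE} => [//|k IH] s x /=; apply: eq_bigr => mu _.
  by apply: eq_bigr => nu _; rewrite IH MA rmorphB.
move=> ->; have -> : z * (2 ^ k * k`!)%:Z = 2%:R ^+ k * (z * (k`!)%:Z).
  by rewrite PoszM mulrCA; congr (_ * _); rewrite -[LHS]natz natrX.
rewrite -zE rmorphM rmorphXn rmorph_nat; congr (_ * _).
rewrite cup_powE rmorph_sum; apply: eq_bigr => t _ /=.
by rewrite rmorphM rmorph_prod big_map big_enum.
Qed.

(** * Integrality of the charge of a quantized closed 2-cochain *)

Section TopologicalCharge.
Variables (F : numFieldType) (T : finZmodType) (L d m : nat) (L_gt0 : (0 < L)%N).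
Hypothesis d_even : d = m.*2.
Variable ev : nat -> T.
Hypothesis evL : forall i, ev i *+ L = 0.
Hypothesis gen : forall f : T -> F, (forall (i : 'I_d) x, f (x + ev i) = f x) ->
  forall x y, f x = f y.
Hypothesis cardT : #|T| = (L ^ d)%N.
Local Notation e := (fun i : 'I_d => ev i).

(** The cochain may be replaced by its full average, which is [L ^ -2] times an integral skew matrix
    [M]. The volume [L ^ d] cancels the [m] factors [L ^ -2] because [d = 2 m], so the Pfaffian
    statement for [M] remains. *)
Lemma charge_integral (f : 'I_d -> 'I_d -> T -> F) a (n : 'I_d -> 'I_d -> T -> int) :
  closed2 e f -> skew2 f ->
  (forall mu nu x, f mu nu x = dcoch e a mu nu x + (n mu nu x)%:~R) ->
  exists z : int, \sum_x cup e (nseq m (C2 f)) [::] x = (z * (2 ^ m * m`!)%:Z)%:~R.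
Proof.
move=> cf sf fE; have := flux_integral L_gt0 evL gen cf sf fE.
move=> H; have /fin_all_exists[M ME] mu := fin_all_exists (fun nu => H mu nu 0).
have Ls0 : L%:R ^+ 2 != 0 :> F by rewrite expf_neq0 // pnatr_eq0 -lt0n.
have cE mu nu x : avgs L ev d (f mu nu) x = L%:R ^- 2 * (M mu nu)%:~R.
  by rewrite -ME mulKf //; apply: avgs_const.
have avgs_skew k mu nu x : avgs L ev k (f mu nu) x = - avgs L ev k (f nu mu) x.
  elim: k mu nu x => [|k IH] mu nu x /=; first exact: sf.
  exact: (@skew_avg F T L d (ev k) (fun mu nu => avgs L ev k (f mu nu)) IH).
have Mskew mu nu : M mu nu = - M nu mu.
  apply: (@intr_inj F); rewrite rmorphN -ME /=.
  by rewrite avgs_skew mulrN ME.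
rewrite (cup_pow_avgs L_gt0 m (leqnn d) cf sf).
have [z zE] := pfaffian_integral F e m 0 Mskew; exists z; rewrite -zE.
move: cE; set c := L%:R ^- 2 => cE.
have cupE k s x y : cup e (nseq k (C2 (fun mu nu => avgs L ev d (f mu nu)))) s x =
   c ^+ k * cup e (nseq k (C2 (fun mu nu _ => (M mu nu)%:~R))) s y.
  elim: k s x y => [|k IH] s x y /=; first by rewrite expr0 mul1r.
  rewrite mulr_sumr; apply: eq_bigr => mu _; rewrite mulr_sumr.
  apply: eq_bigr => nu _.
  by rewrite cE (IH _ _ (y + ev mu + ev nu)) exprS -!mulrA; congr (_ * _); rewrite mulrCA.
under eq_bigr do rewrite (cupE _ _ _ 0).
rewrite sumr_const cardT -mulr_natl mulrA natrX /c exprVn -exprM mul2n -d_even divff ?mul1r //.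
by rewrite expf_neq0 // pnatr_eq0 -lt0n.
Qed.

End TopologicalCharge.

(** * Integrality of the index from the Ginsparg-Wilson relation *)

Lemma mxtrace_idempotent (F : fieldType) n (P : 'M[F]_n) :
  P *m P = P -> \tr P = (\rank P)%:R.
Proof.
move=> PP; move: (col_base P) (row_base P) (col_base_full P) (row_base_free P)
  (mulmx_base P) => C B Cfull Bfree CB.
(* Cancelling the full-rank outer factors in [C B C B = C B] gives [B C = 1], an identity matrix
   whose size is the rank. *)
suff BC : B *m C = 1%:M by rewrite -{1}CB mxtrace_mulC BC mxtrace1.
apply: (row_free_inj Bfree); apply: (row_full_inj Cfull).
by rewrite mul1mx !mulmxA CB -mulmxA CB PP.
Qed.

(* [G] and [G (1 - D)] are both involutions, and the trace is half the sum of
   their traces. *)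
Lemma index_integral (F : numFieldType) n (G D : 'M[F]_n) :
  G *m G = 1%:M -> G *m D + D *m G = D *m G *m D ->
  exists k : int, \tr (G *m (1%:M - 2%:R^-1 *: D)) = k%:~R.
Proof.
move=> GG GW; pose H := G *m (1%:M - D).
have GDGD : G *m D *m G *m D = D + G *m D *m G.
  by rewrite -!mulmxA [D *m (G *m D)]mulmxA -GW mulmxDr !mulmxA GG mul1mx.
have HH : H *m H = 1%:M.
  rewrite /H !mulmxBr !mulmxBl !mulmx1 !mulmxA GG mul1mx GDGD.
  by rewrite opprB [D + _]addrC addrK subrK.
pose P (K : 'M[F]_n) := 2%:R^-1 *: (1%:M + K).
have n2 : 2%:R != 0 :> F by rewrite pnatr_eq0.
have trP K : K *m K = 1%:M -> 2%:R^-1 * (n%:R + \tr K) = (\rank (P K))%:R.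
  move=> KK; rewrite -mxtrace_idempotent.
    by rewrite /P mxtraceZ mxtraceD mxtrace1.
  rewrite /P -scalemxAl -scalemxAr mulmxDl !mulmxDr !mul1mx mulmx1 KK.
  rewrite [K + _]addrC -mulr2n -[(1%:M + K) *+ 2]scaler_nat !scalerA; congr (_ *: _).
  by rewrite -?mulrA mulVf // mulr1.
(* An involution [K] has trace [2 * \rank (P K) - n]; the witness is half the sum for [G] and
   [H]. *)
exists ((\rank (P G))%:Z + (\rank (P H))%:Z - n%:Z).
have -> : G *m (1%:M - 2%:R^-1 *: D) = 2%:R^-1 *: (G + H).
  rewrite /H !mulmxBr mulmx1 -scalemxAr scalerDr scalerBr addrA -scalerDl.
  have -> : 2%:R^-1 + 2%:R^-1 = 1 :> F by field.
  by rewrite scale1r.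
rewrite mxtraceZ mxtraceD rmorphB rmorphD /= -!pmulrn -!trP //.
by field.
Qed.

(** Kernels are flattened into matrices indexed by a site and a spinor index. Kernel composition
    becomes matrix multiplication and [g] becomes block diagonal, so the matrix case applies. *)
Lemma block_index_integral (F : numFieldType) (X : finType) n (g : 'M[F]_n)
    (K : X -> X -> 'M[F]_n) : g *m g = 1%:M ->
  (forall x y, g *m K x y + K x y *m g = \sum_z K x z *m g *m K z y) ->
  exists k : int, \sum_x \tr (g *m (1%:M - 2%:R^-1 *: K x x)) = k%:~R.
Proof.
move=> gg GW; pose I : finType := (X * 'I_n)%type.
pose big (B : X -> X -> 'M[F]_n) : 'M[F]_#|I| :=
  \matrix_(i, j) B (enum_val i).1 (enum_val j).1 (enum_val i).2 (enum_val j).2.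
pose dg (h : 'M[F]_n) (x y : X) : 'M[F]_n := if x == y then h else 0.
have bigM B B' : big B *m big B' = big (fun x y => \sum_z B x z *m B' z y).
  apply/matrixP => i j; rewrite !mxE.
  under eq_bigr do rewrite !mxE.
  pose G (p : I) := B (enum_val i).1 p.1 (enum_val i).2 p.2 *
                    B' p.1 (enum_val j).1 p.2 (enum_val j).2.
  rewrite -(big_enum_val (A := I) G) /= -(pair_bigA _ (fun a b => G (a, b))) /=.
  by rewrite summxE; apply: eq_bigr => z _; rewrite mxE.
have eq_big B B' : (forall x y, B x y = B' x y) -> big B = big B'.
  by move=> BB; apply/matrixP => i j; rewrite !mxE BB.
have dgl h (B : X -> X -> 'M[F]_n) x y : \sum_z dg h x z *m B z y = h *m B x y.
  rewrite (bigD1 x) //= /dg eqxx big1 ?addr0 // => z; rewrite eq_sym => /negPf->.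
  by rewrite mul0mx.
have dgr h (B : X -> X -> 'M[F]_n) x y : \sum_z B x z *m dg h z y = B x y *m h.
  rewrite (bigD1 y) //= /dg eqxx big1 ?addr0 // => z => /negPf->.
  by rewrite mulmx0.
have big1 : big (dg 1%:M) = 1%:M.
  apply/matrixP => i j; rewrite !mxE /dg -(inj_eq enum_val_inj) -pair_eqE /=.
  by case: eqP => _; rewrite mxE.
have bigD B B' : big B + big B' = big (fun x y => B x y + B' x y).
  by apply/matrixP => i j; rewrite !mxE.
have bigZ c B : c *: big B = big (fun x y => c *: B x y).
  by apply/matrixP => i j; rewrite !mxE.
have bigT B : \tr (big B) = \sum_x \tr (B x x).
  rewrite /mxtrace; under eq_bigr do rewrite mxE.
  pose G (p : I) := B p.1 p.1 p.2 p.2.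
  by rewrite -(big_enum_val (A := I) G) /= -(pair_bigA _ (fun a b => G (a, b))).
have [||k kE] := @index_integral F #|I| (big (dg g)) (big K).
- rewrite bigM -big1; apply: eq_big => x y; rewrite (dgl g (dg g)) /dg.
  by case: eqP => _; rewrite ?gg ?mulmx0.
- rewrite !bigM bigD; apply: eq_big => x y; rewrite (dgl g K) (dgr g K) GW.
  by apply: eq_bigr => z _; rewrite (dgr g K).
exists k; rewrite -kE -big1 -scaleN1r !bigZ bigD bigM bigT.
apply: eq_bigr => x _.
rewrite (dgl g (fun x y => dg 1%:M x y + -1 *: (2%:R^-1 *: K x y))) /dg eqxx.
by rewrite scalerA mulN1r scaleNr.
Qed.

Lemma anticomm_prod (F : comNzRingType) n k (h : 'M[F]_n) (g : 'I_k -> 'M[F]_n) :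
  (forall i, h *m g i = - (g i *m h)) ->
  h *m (\prod_i g i) = (-1) ^+ k *: (\prod_i g i *m h).
Proof.
elim: k g => [|k IH] g gh; first by rewrite !big_ord0 mulmx1 mul1mx scale1r.
rewrite big_ord_recr /=; set P := \prod_(i < k) _.
rewrite -[P * _]/(P *m _) mulmxA IH // -scalemxAl -mulmxA gh mulmxN scalerN mulmxA.
by rewrite exprS mulN1r scaleNr.
Qed.

(** Reordering the squared product of [k] gamma matrices costs ['C(k, 2)] signs, and the squared
    prefactor contributes [(-1) ^+ d./2]. For even [d] the total exponent is even. *)
Lemma chirality_sqr (R : realType) d (gam : 'I_d -> spin R d) : ~~ odd d ->
  clifford gam -> chirality gam *m chirality gam = 1%:M.
Proof.
move=> ed [hg _].
have n2 : 2%:R != 0 :> R[i] by rewrite pnatr_eq0.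
have sq k (g : 'I_k -> spin R d) :
  (forall mu nu, g mu *m g nu + g nu *m g mu = ((mu == nu)%:R *+ 2) *: 1%:M) ->
  (\prod_mu g mu) *m (\prod_mu g mu) = (-1) ^+ 'C(k, 2) *: 1%:M.
  elim: k g => [|k IH] g g_anti; first by rewrite big_ord0 mulmx1 scale1r.
  rewrite big_ord_recr /=; set P := \prod_(i < k) _; set h := g ord_max.
  have hh : h *m h = 1%:M.
    have := g_anti ord_max ord_max; rewrite eqxx -/h -mulr2n -scaler_nat.
    by move/(scalerI n2).
  have hP : h *m P = (-1) ^+ k *: (P *m h).
    apply: anticomm_prod => i; apply/eqP; rewrite -addr_eq0 g_anti.
    have /negPf-> : ord_max != widen_ord (leqnSn k) i by rewrite -val_eqE /= gtn_eqF.
    by rewrite mul0rn scale0r.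
  have PP : P *m P = (-1) ^+ 'C(k, 2) *: 1%:M.
    apply: IH => mu nu; by rewrite g_anti -val_eqE.
  rewrite -[P * h]/(P *m h) -mulmxA [h *m (P *m h)]mulmxA hP -scalemxAl -mulmxA hh mulmx1.
  by rewrite -scalemxAr PP scalerA -exprD binS bin1 addnC.
rewrite /chirality -scalemxAl -scalemxAr sq // !scalerA -exprMn -expr2 sqrCi.
rewrite -exprD -signr_odd; suff -> : odd (d./2 + 'C(d, 2)) = false by rewrite scale1r.
rewrite -{2}(even_halfK ed) bin2 -doubleMl doubleK oddD oddM; case: (d./2) => //= k.
by rewrite odd_double andbT addbb.
Qed.

(** * Phases and arguments of unit complex numbers *)

Section Phases.
Variable R : realType.
Implicit Types (z w : R[i]) (t u : R).

Definition expi t : R[i] := cos t +i* sin t.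

Lemma expi0 : expi 0 = 1. Proof. by rewrite /expi cos0 sin0. Qed.

Lemma expiD t u : expi (t + u) = expi t * expi u.
Proof.
rewrite /expi cosD sinD; apply/eqP; rewrite eq_complex /= eqxx /=.
by apply/eqP; ring.
Qed.

Lemma expiN t : expi (- t) = (expi t)^-1.
Proof.
have tE : expi (- t) * expi t = 1 by rewrite -expiD addNr expi0.
have e0 : expi t != 0.
  by apply: contra_eq_neq tE => ->; rewrite mulr0 eq_sym oner_eq0.
by rewrite -[LHS](mulfK e0) tE mul1r.
Qed.

Lemma normc_cabs z : `|z| = (cabs z)%:C.
Proof. by rewrite normc_def. Qed.

Lemma cabsM z w : cabs (z * w) = cabs z * cabs w.
Proof. by apply: complexI; rewrite rmorphM /= -!normc_cabs normrM. Qed.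

Lemma cabsV z : cabs z^-1 = (cabs z)^-1.
Proof. by apply: complexI; rewrite fmorphV /= -!normc_cabs normfV. Qed.

(** Since [carg] is a choice, the content is the existence of an argument in the half-open interval:
    plus or minus [acos] of the real part, according to the sign of the imaginary part. *)
Lemma expi_carg z : cabs z = 1 -> expi (carg z) = z.
Proof.
move=> z1; rewrite /carg; set P := [set t | _].
suff /(xgetPex (0 : R))[_ []] : exists t, P t.
  by rewrite z1 !mul1r => zc zs; rewrite /expi -zc -zs; case: (z).
rewrite /P /= z1; case: z {P} z1 => a b /= z1.
have ab : a ^+ 2 + b ^+ 2 = 1.
  by rewrite -[LHS]sqr_sqrtr ?addr_ge0 ?sqr_ge0 // [Num.sqrt _]z1 expr1n.
have a1 : -1 <= a <= 1.
  by rewrite -ler_norml -(@expr_le1 _ 2%N) ?normr_ge0 // real_normK ?num_real // -ab lerDl sqr_ge0.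
have ca : cos (acos a) = a by rewrite acosK // in_itv.
have sa : sin (acos a) = `|b|.
  by rewrite sin_acos // -ab addrAC subrr add0r sqrtr_sqr.
have [b0|b0] := leP 0 b.
  exists (acos a); rewrite ca sa !mul1r ger0_norm // acos_lepi //; split=> //; split=> //.
  by rewrite (lt_le_trans _ (acos_ge0 a1)) // oppr_lt0 pi_gt0.
exists (- acos a); rewrite cosN sinN ca sa !mul1r ltr0_norm // opprK; split=> //; split.
  (* The lower bound must be strict: real part -1 would force the imaginary part to be zero, against
     [b < 0]. *)
  rewrite ltrN2 acos_ltpi //; case/andP: (a1) => a1' ->; rewrite andbT lt_neqAle a1' andbT.
  apply: contraTneq b0 => aN1; move: ab; rewrite -aN1 sqrrN expr1n => /eqP.
  by rewrite -subr_eq0 addrAC subrr add0r sqrf_eq0 => /eqP->; rewrite ltxx.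
by rewrite (le_trans _ (pi_ge0 R)) // oppr_le0 acos_ge0.
Qed.

Lemma expi_int (k : int) : expi (pi *+ 2 * k%:~R) = 1.
Proof.
have en (n : nat) : expi (pi *+ 2 * n%:R) = 1.
  elim: n => [|n IH]; first by rewrite mulr0 expi0.
  by rewrite -[n.+1]addn1 natrD mulrDr mulr1 expiD IH mul1r /expi cos2pi sin2pi.
case: k => n; first exact: en.
by rewrite NegzE rmorphN mulrN expiN en invr1.
Qed.

Lemma expi_eq1 t : expi t = 1 -> exists k : int, t = pi *+ 2 * k%:~R.
Proof.
(* Subtracting the integral number of turns leaves a remainder in [[0, 2 pi)] with cosine 1 and sine
   0, hence zero. *)
move=> t1; pose k := Num.floor (t / (pi *+ 2)); exists k.
have p0 : 0 < pi *+ 2 :> R by rewrite pmulrn_lgt0 ?pi_gt0.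
pose r := t - pi *+ 2 * k%:~R.
have r0 : 0 <= r by rewrite subr_ge0 mulrC -ler_pdivlMr // floor_le.
have r2 : r < pi *+ 2.
  rewrite ltrBlDl -{2}[pi *+ 2]mulr1 -mulrDr mulrC -ltr_pdivrMr //.
  by have := floorD1_gt (t / (pi *+ 2)); rewrite rmorphD.
have r1 : expi r = 1 by rewrite /r expiD t1 expiN expi_int invr1 mulr1.
suff : r = 0 by move/eqP; rewrite subr_eq0 => /eqP.
have [cr sr] : cos r = 1 /\ sin r = 0 by case: r1.
apply/eqP; rewrite eq_le r0 andbT leNgt; apply/negP => rp.
have [rpi|rpi|rpi] := ltgtP r pi.
- by have := sin_gt0_pi (introT andP (conj rp rpi)); rewrite sr ltxx.
- have : 0 < r - pi < pi by rewrite subr_gt0 rpi ltrBlDl -mulr2n r2.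
  by move/sin_gt0_pi; rewrite sinB sr sinpi cospi mul0r mulr0 subr0 ltxx.
- by move: cr; rewrite rpi cospi; lra.
Qed.

Lemma int_lt1_eq0 (F : numDomainType) (k : int) : `|k%:~R : F| < 1 -> k = 0.
Proof. by rewrite -intr_norm ltrz1; case: k => [[|n]|n]. Qed.

Variable d : nat.
Implicit Type U : gfield R d.

Lemma cabs_plaq U x mu nu : U1field U -> cabs (plaq U x mu nu) = 1.
Proof. by move=> hU; rewrite /plaq !cabsM !cabsV !hU invr1 !mulr1. Qed.

(** This is [F = dA + 2 pi n] in units of [2 pi]: the plaquette phase and the sum of its link phases
    have the same exponential. *)
Lemma carg_plaq U x mu nu : U1field U -> exists k : int,
  carg (plaq U x mu nu) / (pi *+ 2) =
    (carg (U (x + uvec mu) nu) - carg (U x nu)) / (pi *+ 2)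
    - (carg (U (x + uvec nu) mu) - carg (U x mu)) / (pi *+ 2) + k%:~R.
Proof.
move=> hU; set a := carg (plaq _ _ _ _).
set b := carg (U (x + uvec mu) nu); set c := carg (U x nu).
set b' := carg (U (x + uvec nu) mu); set c' := carg (U x mu).
have [|k kE] := @expi_eq1 (a - (c' + b - b' - c)).
  rewrite !(expiD, expiN) !expi_carg ?cabs_plaq ?hU //.
  rewrite -/(plaq U x mu nu) divff //.
  apply/eqP => p0; have := cabs_plaq x mu nu hU.
  by rewrite p0 /cabs /= expr0n addr0 sqrtr0 => /eqP; rewrite eq_sym oner_eq0.
have p0 : pi *+ 2 != 0 :> R by rewrite mulrn_eq0 /= gt_eqF ?pi_gt0.
exists k; apply: (mulfI p0); move/eqP: kE; rewrite subr_eq => /eqP ->.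
by move: (pi *+ 2) p0 => P P0; field.
Qed.

End Phases.

(** * The periodic lattice as a finite abelian group *)

Definition torus (d n : nat) : Type := {ffun 'I_d -> 'I_n.+1}.
HB.instance Definition _ d n := Finite.on (torus d n).
HB.instance Definition _ d n := GRing.Zmodule.on (torus d n).

Section Torus.
Variables d n : nat.
Local Notation L := n.+1.

(* [i] ranges over all naturals so that [avgs] can recurse on it. *)
Definition tvec (i : nat) : torus d n := [ffun mu : 'I_d => inZp (val mu == i)].

Definition proj (x : site d) : torus d n :=
  [ffun mu => inZp `|(x mu %% L%:Z)%Z|%N].

Lemma tvecL i : tvec i *+ L = 0.
Proof.
apply/ffunP => mu; rewrite ffunMnE !ffunE; apply: val_inj.
by rewrite Zp_mulrn /= modnMl.
Qed.

Lemma card_torus : #|{: torus d n}| = (L ^ d)%N.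
Proof. by rewrite card_ffun !card_ord. Qed.

Lemma tvec_decomp (x : torus d n) : x = \sum_(mu < d) tvec mu *+ x mu.
Proof.
apply/ffunP => nu; rewrite sum_ffunE (bigD1 nu) //= big1 => [|mu neq].
  rewrite addr0 ffunMnE ffunE eqxx Zp_mulrn; apply: val_inj => /=.
  by rewrite modnMml mul1n modn_small.
rewrite ffunMnE ffunE Zp_mulrn; apply: val_inj => /=.
by rewrite val_eqE eq_sym (negPf neq) modnMml mul0n mod0n.
Qed.

Lemma torus_gen (A : Type) (f : torus d n -> A) :
  (forall (i : 'I_d) x, f (x + tvec i) = f x) -> forall x y, f x = f y.
Proof.
move=> fi; have fk (i : 'I_d) k x : f (x + tvec i *+ k) = f x.
  by elim: k => [|k IH]; rewrite ?addr0 // mulrSr addrA fi.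
suff f0 x : f x = f 0 by move=> x y; rewrite f0 [RHS]f0.
rewrite (tvec_decomp x); elim/big_rec: _ => // i y _ <-.
by rewrite addrC fk.
Qed.

Lemma projD x y : proj (x + y) = proj x + proj y.
Proof.
apply/ffunP => mu; rewrite !ffunE; apply: val_inj => /=.
have posm (a : int) : (a %% L)%Z = `|(a %% L)%Z|%N :> int by rewrite gez0_abs ?modz_ge0.
by rewrite modnDm -modzDm (posm (x mu)) (posm (y mu)) -PoszD modz_nat !absz_nat modn_mod.
Qed.

Lemma proj_uvec mu : proj (uvec mu) = tvec mu.
Proof.
apply/ffunP => nu; rewrite !ffunE; apply: val_inj => /=.
by rewrite modz_nat absz_nat modn_mod.
Qed.

Lemma proj0 : proj 0 = 0.
Proof. by apply: (addrI (proj 0)); rewrite -projD !addr0. Qed.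

Lemma projB x y : proj (x - y) = proj x - proj y.
Proof. by apply: (addIr (proj y)); rewrite -projD !subrK. Qed.

Lemma proj_lvec nu : proj (lvec L nu) = 0.
Proof.
apply/ffunP => mu; rewrite !ffunE; apply: val_inj => /=.
by rewrite PoszM modzMr mod0n.
Qed.

Lemma proj_emb (t : torus d n) : proj (emb t) = t.
Proof.
apply/ffunP => mu; rewrite !ffunE; apply: val_inj => /=.
by rewrite modz_nat absz_nat modn_mod modn_small.
Qed.

Lemma emb_inG (t : torus d n) : inG L (emb t).
Proof. by move=> mu; rewrite ffunE; split; rewrite ?ltz_nat. Qed.

Lemma inG_emb x : inG L x -> emb (proj x) = x.
Proof.
move=> xG; apply/ffunP => mu; rewrite !ffunE /=; have [x0 xL] := xG mu.
case: (x mu) x0 xL => // k _; rewrite ltz_nat => kL.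
by rewrite modz_nat absz_nat modn_mod modn_small.
Qed.

Lemma periodic_emb (A : Type) (f : site d -> A) :
  (forall x nu, f (x + lvec L nu) = f x) -> forall x, f (emb (proj x)) = f x.
Proof.
move=> fp x.
have fz nu (k : int) y : f (y + lvec L nu *~ k) = f y.
  have fk (j : nat) z : f (z + lvec L nu *+ j) = f z.
    by elim: j z => [|j IH] z; rewrite ?mulr0n ?addr0 // mulrSr addrA fp.
  by case: k => j; rewrite ?NegzE ?mulrNz -pmulrn // -{2}[y](subrK (lvec L nu *+ j.+1)) fk.
set z := emb (proj x).
have xE : x = z + \sum_(nu < d) lvec L nu *~ (x nu %/ L%:Z)%Z.
  apply/ffunP => mu; rewrite ffunE sum_ffunE (bigD1 mu) //= big1 => [|nu neq].
    rewrite addr0 ffunMzE !ffunE eqxx muln1 /= mulrzz mulrC.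
    rewrite modn_small ?gez0_abs ?modz_ge0 // -?ltz_nat ?gez0_abs ?modz_ge0 ?ltz_mod //.
    by rewrite addrC -divz_eq.
  by rewrite ffunMzE ffunE eq_sym (negPf neq) muln0 mul0rz.
rewrite [in RHS]xE; elim/big_rec: _ => [|i y _ IH]; first by rewrite addr0.
by rewrite IH [_ + y]addrC addrA fz.
Qed.

End Torus.

(** * The lattice topological charge of an admissible gauge field *)

Section Charge.
Variables (R : realType) (d n : nat) (eps : R) (U : gfield R d).
Hypotheses (adm : admissible eps U) (per : periodicU n.+1 U).
Local Notation L := n.+1.
Local Notation T := (torus d n).
Local Notation e := (fun i : 'I_d => tvec d n i).

Definition phase (mu : 'I_d) (t : T) : R := carg (U (emb t) mu) / (pi *+ 2).

Definition flux (mu nu : 'I_d) (t : T) : R := carg (plaq U (emb t) mu nu) / (pi *+ 2).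

Lemma link_emb (t : T) (mu nu : 'I_d) : U (emb t + uvec mu) nu = U (emb (t + tvec d n mu)) nu.
Proof.
rewrite -(periodic_emb (f := fun x => U x nu) (n := n)) => [|x la]; last exact: per.
by rewrite projD proj_emb proj_uvec.
Qed.

Lemma plaq_emb x mu nu : plaq U (emb (proj n x)) mu nu = plaq U x mu nu.
Proof.
apply: (periodic_emb (f := fun x => plaq U x mu nu)) => y la.
by rewrite /plaq (addrAC y _ (uvec mu)) (addrAC y _ (uvec nu)) !per.
Qed.

Lemma flux_dcoch : exists k : 'I_d -> 'I_d -> T -> int, forall mu nu t,
  flux mu nu t = dcoch e phase mu nu t + (k mu nu t)%:~R.
Proof.
have /choice[k kE] : forall p : 'I_d * 'I_d * T, exists k : int,
    flux p.1.1 p.1.2 p.2 = dcoch e phase p.1.1 p.1.2 p.2 + k%:~R.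
  move=> [[mu nu] t] /=.
  have [k kE] := carg_plaq (emb t) mu nu adm.1; exists k.
  by rewrite /flux kE /dcoch /phase !link_emb -!mulrBl.
by exists (fun mu nu t => k (mu, nu, t)) => mu nu t; rewrite (kE (mu, nu, t)).
Qed.

(** The bound [pi / 3] becomes 1/6 in units of [2 pi], so the six faces of a cube add up to less
    than 1. *)
Lemma flux_lt mu nu t : `|flux mu nu t| < 6%:R^-1.
Proof.
have [_] := adm.2 (emb t) mu nu; rewrite /flux.
move: (pi : R) (pi_gt0 R) => P P0 h; have P20 : 0 < P *+ 2 by rewrite pmulrn_lgt0.
rewrite normrM normfV (gtr0_norm P20) ltr_pdivrMr //.
by apply: lt_le_trans h _; lra.
Qed.

(** The exact parts cancel in the sum of the two orientations, which is thus an integer of absolute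
    value below 1/3. *)
Lemma flux_skew : skew2 flux.
Proof.
move=> mu nu t; have [k kE] := flux_dcoch.
have h1 := flux_lt mu nu t; have h2 := flux_lt nu mu t.
have E : flux mu nu t + flux nu mu t = (k mu nu t + k nu mu t)%:~R.
  by rewrite !kE rmorphD /dcoch /=; ring.
have /int_lt1_eq0 k0 : `|(k mu nu t + k nu mu t)%:~R : R| < 1.
  by rewrite -E; move: h1 h2; rewrite !ltr_norml => /andP[? ?] /andP[? ?]; apply/andP; split; lra.
by move: E; rewrite k0; lra.
Qed.

(** Bianchi identity: the link phases cancel over a cube, so the sum of its six faces is an integer,
    and it is smaller than 1 in absolute value. *)
Lemma flux_closed : closed2 e flux.
Proof.
move=> la mu nu t; have [k kE] := flux_dcoch.
set S := (X in X = 0).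
have [z zE] : exists z : int, S = z%:~R.
  exists (k mu nu (t + e la) - k mu nu t + (k nu la (t + e mu) - k nu la t)
          + (k la mu (t + e nu) - k la mu t)).
  rewrite /S !kE !(rmorphD, rmorphN) /= /dcoch (addrAC t (e mu) (e la)).
  rewrite (addrAC t (e nu) (e la)) (addrAC t (e nu) (e mu)); ring.
suff /int_lt1_eq0 z0 : `|z%:~R : R| < 1 by rewrite zE z0.
rewrite -zE /S; move: (flux_lt mu nu (t + e la)) (flux_lt mu nu t)
  (flux_lt nu la (t + e mu)) (flux_lt nu la t) (flux_lt la mu (t + e nu)) (flux_lt la mu t).
rewrite !ltr_norml => /andP[? ?] /andP[? ?] /andP[? ?] /andP[? ?] /andP[? ?] /andP[? ?].
by apply/andP; split; lra.
Qed.

(** Each [F] is [2 pi i] times a flux. The powers of [pi] cancel, [(4 pi) ^ m] leaves [2 ^ m] in the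
    denominator, and the two factors ['i ^+ m] combine to a sign. *)
Lemma qdens_cup N (t : T) : qdens N U (emb t) =
  N%:~R * (-1) ^+ d./2 / (2 ^ d./2 * (d./2)`!)%:R *
    (cup e (nseq d./2 (C2 flux)) [::] t)%:C.
Proof.
rewrite cup_powE /qdens; set m := d./2.
have p0 : (pi *+ 2 : R) != 0 by rewrite mulrn_eq0 /= gt_eqF ?pi_gt0.
pose G (s : {ffun 'I_m -> 'I_d * 'I_d}) : R :=
  (levi (indices [seq s j | j <- enum 'I_m]))%:~R *
  \prod_(j < m) flux (s j).1 (s j).2 (t + \sum_(l < m | (l < j)%N) (e (s l).1 + e (s l).2)).
transitivity (N%:~R * 'i ^+ m / (((4%:R * pi) ^+ m * m`!%:R : R)%:C) *
   \sum_s ('i ^+ m * ((pi *+ 2) ^+ m * G s)%:C)).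
  congr (_ * _); apply: eq_bigr => s _.
  rewrite /G [(pi *+ 2) ^+ m * _]mulrCA !rmorphM /= rmorph_int [RHS]mulrCA; congr (_%:~R * _).
    by congr (levi (flatten _)); elim: (enum _) => //= j r ->.
  rewrite rmorph_prod -[in (pi *+ 2) ^+ m](card_ord m) -prodr_const rmorph_prod.
  rewrite -[in 'i ^+ m](card_ord m) -prodr_const -!big_split /=; apply: eq_bigr => j _.
  rewrite /Ffield; congr (_ * _); rewrite -rmorphM /flux; congr (_%:C).
  rewrite mulrCA divff // mulr1; congr carg; rewrite -plaq_emb; congr (plaq _ (emb _) _ _).
  rewrite projD proj_emb; congr (_ + _).
  rewrite (big_morph _ (@projD d n) (@proj0 d n)); apply: eq_bigr => l _.
  by rewrite projD !proj_uvec.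
rewrite -mulr_sumr -rmorph_sum -mulr_sumr mulrA rmorphM /= mulrA.
congr (_ * _).
set A := ((4%:R * pi) ^+ m * _)%:C; set B := ((pi *+ 2) ^+ m)%:C.
have AB : A^-1 * B = (2 ^ m * m`!)%:R^-1.
  rewrite /A /B -fmorphV -rmorphM /= -(rmorph_nat (real_complex R)) -fmorphV.
  congr (_%:C); rewrite natrM natrX.
  have -> : 4%:R * pi = 2%:R * (pi *+ 2) :> R by rewrite -mulr_natl; ring.
  rewrite exprMn !invfM -!mulrA; congr (_ * _).
  by rewrite mulrCA mulVf ?mulr1 // expf_neq0.
have ii : 'i ^+ m * 'i ^+ m = (-1) ^+ m :> R[i] by rewrite -exprMn -expr2 sqrCi.
by rewrite -AB -ii; ring.
Qed.

(** The denominator [2 ^ m m!] of [q] is exactly the factor by which the summed cup power is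
    divisible. *)
Lemma charge_sum_integral N : ~~ odd d ->
  exists z : int, \sum_(t : T) qdens N U (emb t) = z%:~R.
Proof.
move=> ed; have [k kE] := flux_dcoch.
have [z zE] := charge_integral (ltn0Sn n) (esym (even_halfK ed)) (@tvecL d n)
  (@torus_gen d n R) (@card_torus d n) flux_closed flux_skew kE.
exists (N * (-1) ^+ d./2 * z); under eq_bigr do rewrite qdens_cup.
rewrite -mulr_sumr -rmorph_sum /= zE rmorph_int !intrM -pmulrn [z%:~R * _]mulrC mulrA.
rewrite divfK ?pnatr_eq0 -?lt0n ?muln_gt0 ?expn_gt0 ?fact_gt0 //.
by rewrite rmorphXn rmorphN1.
Qed.

End Charge.

(** * Summed anomalies, exponential estimates and the construction of the current *)

Lemma index_sum_integral (R : realType) d n (gam : 'I_d -> spin R d) (K : kernel R d) :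
  ~~ odd d -> clifford gam -> GW_fin n.+1 (chirality gam) K ->
  exists z : int,
    \sum_(t : torus d n) anomaly (chirality gam) (K (emb t) (emb t)) = z%:~R.
Proof.
move=> ed hg GW; apply: (block_index_integral (K := fun t u : torus d n => K (emb t) (emb u))).
  exact: chirality_sqr.
by move=> t u; apply: GW; apply: emb_inG.
Qed.

Lemma divb_sum (R : realType) d n (k : site d -> 'I_d -> R[i]) :
  (forall x mu nu, k (x + lvec n.+1 nu) mu = k x mu) ->
  \sum_(t : torus d n) divb k (emb t) = 0.
Proof.
move=> kp; rewrite /divb exchange_big big1 // => mu _; rewrite sumrB.
have kE x : k (emb (proj n x)) mu = k x mu.
  by apply: (periodic_emb (f := fun x => k x mu)) => y nu; apply: kp.
under [X in _ - X]eq_bigr do rewrite -kE projB proj_emb proj_uvec.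
by rewrite (sum_shift (fun t : torus d n => k (emb t) mu)) subrr.
Qed.

(** A periodic field is unchanged by the shift by [lvec L nu], so translation covariance of the
    current gives its periodicity. *)
Lemma kinf_periodic (R : realType) d L (eps : R) (U : gfield R d)
    (kinf : gfield R d -> site d -> 'I_d -> R[i]) :
  (forall U z x mu, admissible eps U -> kinf (tshift z U) x mu = kinf U (x + z) mu) ->
  admissible eps U -> periodicU L U ->
  forall x mu nu, kinf U (x + lvec L nu) mu = kinf U x mu.
Proof.
move=> kt adm per x mu nu; rewrite -kt //; congr (kinf _ _ _).
by apply/funext => y; apply/funext => la; apply: per.
Qed.

Lemma cabs_anomalyB (R : realType) d (g A B : spin R d) :
  cabs (anomaly g A - anomaly g B) <=
    2%:R^-1 * (\sum_i \sum_j cabs (g i j)) * mnorm (A - B).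
Proof.
have -> : anomaly g A - anomaly g B = - 2%:R^-1 * \tr (g *m (A - B)).
  by rewrite /anomaly !mulmxBr !mulmx1 -!scalemxAr !raddfB /= !mxtraceZ; ring.
have entry i j : cabs ((A - B) i j) <= mnorm (A - B).
  have c0 : 0 <= cabs ((A - B) i j) by apply: sqrtr_ge0.
  rewrite -[leLHS](ger0_norm c0) -sqrtr_sqr; apply: ler_wsqrtr.
  rewrite (bigD1 i) //= (bigD1 j) //= -addrA lerDl addr_ge0 ?sumr_ge0 // => *.
    exact: sqr_ge0.
  by apply: sumr_ge0 => *; apply: sqr_ge0.
rewrite -lecR -normc_cabs normrM normrN normfV normr_nat !rmorphM /= fmorphV rmorph_nat -mulrA.
rewrite ler_pM2l ?invr_gt0 ?ltr0n // rmorph_sum mulr_suml /mxtrace.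
apply: le_trans (ler_norm_sum _ _ _) _; apply: ler_sum => i _.
rewrite mxE rmorph_sum mulr_suml; apply: le_trans (ler_norm_sum _ _ _) _.
apply: ler_sum => j _; rewrite normrM !normc_cabs; apply: ler_wpM2l.
  by rewrite ler0c sqrtr_ge0.
by rewrite lecR.
Qed.

(** Raises [y <= expR y] to the power [j.+1] for [y = x / (rho * j.+1)]; the spare power of [x]
    gives the decay [1 / x]. *)
Lemma pow_exp_bound (R : realType) (rho x : R) j : 0 < rho -> 0 < x ->
  x ^+ j * expR (- x / rho) <= (rho * j.+1%:R) ^+ j.+1 / x.
Proof.
move=> rho0 x0; pose y := x / (rho * j.+1%:R).
have r0 : 0 < rho * j.+1%:R by rewrite mulr_gt0.
have y0 : 0 < y by rewrite divr_gt0.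
have ey : y ^+ j.+1 <= expR (x / rho).
  have -> : x / rho = j.+1%:R * y.
    by rewrite /y invfM mulrCA [X in _ = x * X]mulrCA divff ?mulr1 // pnatr_eq0.
  rewrite expRM_natl lerXn2r ?nnegrE ?expR_ge0 ?ltW //.
  by apply: lt_le_trans (expR_ge1Dx y); rewrite ltrDr.
rewrite mulNr expRN ler_pdivrMr ?expR_gt0 // mulrAC ler_pdivlMr //.
rewrite -exprSr; apply: le_trans (ler_wpM2l _ ey); last by rewrite exprn_ge0 ?ltW.
by rewrite -exprMn /y mulrCA divff ?mulr1 ?gt_eqF.
Qed.

Lemma gauge_cancel (R : realType) d (Om : site d -> R[i]) x : U1fun Om ->
  Om x * (Om x)^-1 = 1.
Proof.
move=> hOm; rewrite divff //; apply/eqP => O0; have := hOm x.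
by rewrite O0 /cabs /= expr0n addr0 sqrtr0 => /eqP; rewrite eq_sym oner_eq0.
Qed.

(** Serves to make an integer vanish: the volume times the deviation per site drops below 1. The
    real exponent [nu] is dominated by a natural number so that the previous bound applies, and [X]
    enters through its absolute value because its sign is free. *)
Lemma volume_deviation_lt1 (R : realType) (rho nu X : R) (d L : nat) : 0 < rho ->
  let j := (d + Num.bound `|nu|)%N in
  1 + `|X| * (rho * j.+1%:R) ^+ j.+1 <= L%:R ->
  L%:R ^+ d * (X * (L%:R `^ nu) * expR (- L%:R / rho)) < 1.
Proof.
move=> rho0 j; set W := (_ ^+ j.+1) => hL.
have W0 : 0 <= W by rewrite exprn_ge0 // mulr_ge0 ?ltW.
have L1 : 1 <= L%:R :> R by apply: le_trans hL; rewrite lerDl mulr_ge0.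
have L0 : 0 < L%:R :> R by apply: lt_le_trans L1.
have p0 : 0 <= L%:R `^ nu :> R by apply: powR_ge0.
have pb : L%:R `^ nu <= L%:R ^+ Num.bound `|nu| :> R.
  rewrite -powR_mulrn; last exact: ltW.
  apply: (ler_powR L1).
  by apply: le_trans (ler_norm _) _; apply: ltW; apply: archi_boundP.
have e0 : 0 <= expR (- L%:R / rho) by apply: expR_ge0.
apply: (@le_lt_trans _ _ (`|X| * (L%:R ^+ j * expR (- L%:R / rho)))).
  rewrite exprD; set a := L%:R ^+ d; set b := L%:R ^+ _ in pb *.
  have -> : `|X| * (a * b * expR (- L%:R / rho)) = a * (`|X| * b * expR (- L%:R / rho)).
    by ring.
  rewrite ler_wpM2l ?exprn_ge0 // ler_wpM2r //.
  apply: (@le_trans _ _ (`|X| * L%:R `^ nu)); first by rewrite ler_wpM2r // ler_norm.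
  by rewrite ler_wpM2l.
apply: (@le_lt_trans _ _ (`|X| * (W / L%:R))).
  by rewrite ler_wpM2l // pow_exp_bound.
by rewrite mulrA ltr_pdivrMr // mul1r; lra.
Qed.

Theorem theorem3p1 (R : realType) (d : nat) (hd : ~~ odd d)
  (eps : R) (heps : eps < 1 /\ eps < (2%:R - Num.sqrt 2%:R) / (d * d.-1)%:R)
  (rho C kappa nu : R) (p : nat) (hrho : 0 < rho) (N : int)
  (gam : 'I_d -> spin R d) (hgam : clifford gam)
  (D : nat -> gfield R d -> kernel R d) (Dinf : gfield R d -> kernel R d)
  (kinf : gfield R d -> site d -> 'I_d -> R[i])
  (hD : finite_dirac_hyp eps rho C p (chirality gam) D)
  (hDinf : infinite_dirac_hyp eps rho C p (chirality gam) Dinf)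
  (hfs : finite_size_hyp eps rho kappa nu D Dinf)
  (hk : standing_fact eps N (chirality gam) Dinf kinf) :
  exists n kappa1 nu1 : R, forall L : nat, n <= L%:R / rho ->
    exists k : gfield R d -> site d -> 'I_d -> R[i],
      (forall U (Om : site d -> R[i]), admissible eps U -> periodicU L U ->
         U1fun Om -> periodic_fn L Om -> k (gtrans Om U) = k U) /\
      (forall U, admissible eps U -> periodicU L U ->
        [/\ (forall x mu nu, k U (x + lvec L nu) mu = k U x mu),
            (forall x, inG L x ->
               anomaly (chirality gam) (D L U x x) = qdens N U x + divb (k U) x) &
            (forall x mu, inG L x ->
               cabs (k U x mu - kinf U x mu) <=
                 kappa1 * (L%:R `^ nu1) * expR (- L%:R / rho))]).
Proof.
pose g := chirality gam; pose c : R := 2%:R^-1 * \sum_i \sum_j cabs (g i j).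
have c0 : 0 <= c.
  rewrite mulr_ge0 ?invr_ge0 // sumr_ge0 // => i _; rewrite sumr_ge0 // => j _.
  exact: sqrtr_ge0.
pose j := (d + Num.bound `|nu|)%N.
pose W := `|c * kappa| * (rho * j.+1%:R) ^+ j.+1.
have W0 : 0 <= W by rewrite mulr_ge0 // exprn_ge0 // mulr_ge0 ?ltW.
(* The threshold amounts to [1 + W <= L], as the volume estimate requires; the exponent [nu + 1]
   pays for the power of [L] lost in [prim]. *)
exists ((1 + W) / rho), (c * kappa), (nu + 1) => L.
rewrite ler_pM2r ?invr_gt0 // => LW.
have L_gt0 : (0 < L)%N.
  by rewrite lt0n -(pnatr_eq0 R) gt_eqF // (lt_le_trans _ LW) // ltr_wpDr.
(* Writing [L] as a successor gives access to the cyclic group structure on the coordinates. *)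
case: L L_gt0 LW => // n _ LW; set L := n.+1.
case: hk => k_eq k_gauge k_shift _.
pose Del U (t : torus d n) : R[i] :=
  anomaly g (D L U (emb t) (emb t)) - anomaly g (Dinf U (emb t) (emb t)).
(* The correction to [kinf] is the explicit solution of the divergence equation with source [Del U].
   It depends on [U] only through [Del U], so it inherits gauge invariance. *)
exists (fun U x mu => kinf U x mu +
  prim L (tvec d n mu) (avgs L (tvec d n) mu (Del U)) (proj n x)).
split.
  move=> U Om adm per UOm pOm.
  have DelE : Del (gtrans Om U) = Del U.
    apply/funext => t; rewrite /Del.
    have [_ DU _ _] := hD L U adm per; have [_ DinfU _ _] := hDinf U adm.
    rewrite (DU _ UOm pOm _ _ (emb_inG t) (emb_inG t)) (DinfU _ UOm) (gauge_cancel _ UOm).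
    by rewrite !scale1r.
  by rewrite DelE (k_gauge _ _ adm UOm).
move=> U adm per.
have kper := kinf_periodic k_shift adm per.
set B : R := c * kappa * (L%:R `^ nu) * expR (- L%:R / rho).
have DelB t : cabs (Del U t) <= B.
  have -> : B = c * (kappa * (L%:R `^ nu) * expR (- L%:R / rho)) by rewrite /B !mulrA.
  apply: le_trans (cabs_anomalyB _ _ _) _; rewrite -/c; apply: (ler_wpM2l c0).
  exact: (hfs L U adm per _ (emb_inG t)).
have DelBC t : `|Del U t| <= B%:C by rewrite normc_cabs lecR.
have Del0 : \sum_t Del U t = 0.
  have [GW _ _ _] := hD L U adm per.
  have [z1 z1E] := index_sum_integral hd hgam GW.
  have [z2 z2E] := charge_sum_integral adm per N hd.
  (* The divergence of the periodic [kinf U] sums to zero, leaving the index minus the topological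
     charge. *)
  have zE : \sum_t Del U t = (z1 - z2)%:~R.
    rewrite /Del sumrB z1E rmorphB /=; congr (_ - _).
    under eq_bigr do rewrite (k_eq _ adm).
    by rewrite big_split /= z2E divb_sum ?addr0.
  suff /int_lt1_eq0 z0 : `|(z1 - z2)%:~R : R[i]| < 1 by rewrite zE z0.
  rewrite -zE; apply: le_lt_trans (ler_norm_sum _ _ _) _.
  apply: (@le_lt_trans _ _ (\sum_(t : torus d n) B%:C)); first exact: ler_sum.
  rewrite sumr_const card_torus -mulr_natl -(rmorph_nat (real_complex R)) -rmorphM /=.
  rewrite -(rmorph1 (real_complex R)) ltcR natrX.
  exact: volume_deviation_lt1.
split.
- by move=> x mu la; rewrite kper projD proj_lvec addr0.
- move=> x xG; rewrite -(inG_emb xG); set t := proj n x.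
  have -> : anomaly g (D L U (emb t) (emb t)) =
     anomaly g (Dinf U (emb t) (emb t)) + Del U t by rewrite /Del addrC subrK.
  rewrite (k_eq _ adm) -addrA; congr (_ + _).
  rewrite (poisson (ltn0Sn n) (@tvecL d n) (@torus_gen d n R[i]) Del0) -big_split /=.
  apply: eq_bigr => mu _; rewrite projB !proj_emb proj_uvec; ring.
- move=> x mu _; rewrite addrC addKr -lecR -normc_cabs.
  apply: le_trans (norm_prim (ltn0Sn n) _ _ _) _.
    by apply: norm_avgs.
  rewrite -(rmorph_nat (real_complex R)) -rmorphM /= lecR /B powRD;
    last by rewrite pnatr_eq0 implybT.
  rewrite powRr1 // le_eqVlt; apply/orP; left; apply/eqP.
  by rewrite /L; move: (expR _) (_ `^ nu) (c * kappa) => a1 a2 a3; ring.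
Qed.
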